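(* Assume that $N(s)$, $s\ge 0$, is an OS-point process (order statistic point process). Fix $t>0$ and assume that the associated cumulative distribution function $F_t$ is absolutely continuous with density $f_t$. Let the distribution of each claim size $X_i$ depend on the claim arrival process only via the times $T_{i-1}$ and $T_i$. Then $$ \mathbf{E}[S(t)]=\sum_{n=1}^{\infty}\pi_{t,n}\Bigg\{ n\int_0^t \mathbf{E}\big[X_1\,|\,T_1=y\big]\,f_t(y)(1-F_t(y))^{n-1}\,dy $$ $$ \qquad +\sum_{i=2}^n \frac{n!}{(i-2)!(n-i)!}\int_0^t\int_0^y \mathbf{E}\big[X_i\,|\,T_{i-1}=x,T_i=y\big]\, f_t(x)f_t(y)F_t^{i-2}(x)(1-F_t(y))^{n-i}\,dx\,dy\Bigg\}. $$
   Context: Setting. $0<T_1<T_2<\cdots$ are the claim arrival times, with $T_0=0$ (and $T_i=\infty$ if there are fewer than $i$ claims); $X_1,X_2,\dots$ are the corresponding claim sizes (random variables). $N(s)$ is the number of claims arriving up to and including time $s$, i.e. the largest integer $m$ with $T_m\le s$; $N(0)=0$ and $N$ is right-continuous with unit jumps at the $T_i$. The aggregate claim size is $S(t)=\sum_{i=1}^{N(t)}X_i$, with $S(t)=0$ when $N(t)=0$. Put $\pi_{t,n}=\mathbf{P}[N(t)=n]$. OS-point process: $N$ is an OS-point process if for every $t>0$ and every $n\ge 0$ with $\pi_{t,n}>0$, conditionally on $N(t)=n$, the arrival times $T_1,\dots,T_n$ have the same joint distribution as the order statistics of $n$ i.i.d. random variables with a common cumulative distribution function $F_t(x)$, $x\ge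 0$ (depending on $t$ but not on $n$), such that $F_t(t)=1$. ''The distribution of $X_i$ depends on the claim arrival process only via $T_{i-1}$ and $T_i$'' means: on $\{T_i<\infty\}$, the conditional distribution of $X_i$ given the whole process $(N(s))_{s\ge0}$ is a function of $(T_{i-1},T_i)$ only. Conditional expectations such as $\mathbf{E}[X_i|T_{i-1}=x,T_i=y]$ denote the corresponding regression functions. Empty sums are $0$ and $0^0=1$. *)

(* Defs.v *)
From HB Require Import structures.
From mathcomp Require Import all_boot all_order all_algebra.
From mathcomp Require Import all_classical all_reals all_analysis.
From mathcomp Require Import measurable_realfun.
Import Order.TTheory GRing.Theory Num.Theory.
Import numFieldNormedType.Exports.

Set Implicit Arguments.
Unset Strict Implicit.
Unset Printing Implicit Defensive.

Local Open Scope classical_set_scope.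
Local Open Scope ring_scope.
Local Open Scope ereal_scope.

(* The value +oo of T i encodes "fewer than i claims". The last field says that
   N s is the largest m with T m <= s; in particular the arrival times do not
   accumulate at a finite time. Only N s with 0 <= s is constrained. *)
Record claim_arrivals d (Om : measurableType d) (R : realType)
    (T : nat -> Om -> \bar R) (N : R -> Om -> nat) : Prop := {
  arrival_measurable : forall i, measurable_fun [set: Om] (T i) ;
  arrival0 : forall w, T 0%N w = 0 ;
  arrival_lt : forall i w, T i w < +oo -> T i w < T i.+1 w ;
  arrival_oo : forall i w, T i w = +oo -> T i.+1 w = +oo ;
  arrival_count : forall (s : R) w, (0 <= s)%R ->
    T (N s w) w <= s%:E /\ (forall m, T m w <= s%:E -> (m <= N s w)%N) }.

(* The time of the i-th claim as a real number, meaningful on {T_i < +oo}. *)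
Definition arrival d (Om : measurableType d) (R : realType)
  (T : nat -> Om -> \bar R) (i : nat) (w : Om) : R := fine (T i w).

Definition occurs d (Om : measurableType d) (R : realType)
  (T : nat -> Om -> \bar R) (i : nat) : set Om := [set w | T i w < +oo].

Definition arrival_pair d (Om : measurableType d) (R : realType)
  (T : nat -> Om -> \bar R) (i : nat) (w : Om) : R * R :=
  (arrival T i.-1 w, arrival T i w).

Definition arrival_tuple d (Om : measurableType d) (R : realType)
  (T : nat -> Om -> \bar R) (n : nat) (w : Om) : n.-tuple R :=
  [tuple arrival T i.+1 w | i < n].

(* Claims are numbered from 1: X 0 is not used. *)
Definition aggregate d (Om : measurableType d) (R : realType)
  (N : R -> Om -> nat) (X : nat -> Om -> R) (t : R) (w : Om) : R :=
  (\sum_(1 <= i < (N t w).+1) X i w)%R.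

Definition count_prob d (Om : measurableType d) (R : realType)
  (P : probability Om R) (N : R -> Om -> nat) (t : R) (n : nat) : \bar R :=
  P [set w | N t w = n].

(* The product rule over all families B covers subfamilies by B i = setT. *)
Definition mutually_independent d (Om : measurableType d) (R : realType)
  (Q : probability Om R) (n : nat) (U : 'I_n -> {RV Q >-> R}) : Prop :=
  forall B : 'I_n -> set R, (forall i, measurable (B i)) ->
    Q [set w | forall i, B i (U i w)] = \prod_(i < n) Q (U i @^-1` B i).

Definition order_statistics (Om : Type) (R : realType) (n : nat)
  (U : 'I_n -> Om -> R) (w : Om) : n.-tuple R :=
  [tuple of sort <=%R [tuple U i w | i < n]].

(* P[(T_1,...,T_n) in B | N(t) = n] is multiplied out by P[N(t) = n] > 0. *)
Definition os_point_process d (Om : measurableType d) (R : realType)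
  (P : probability Om R) (T : nat -> Om -> \bar R) (N : R -> Om -> nat)
  (F : R -> cumulativeBounded (0 : R) (1 : R)) : Prop :=
  forall t : R, (0 < t)%R ->
    [/\ F t t = 1%R,
        forall x, (x < 0)%R -> F t x = 0%R
      & forall n : nat, 0 < count_prob P N t n ->
        exists (d' : measure_display) (Om' : measurableType d')
               (Q : probability Om' R) (U : 'I_n -> {RV Q >-> R}),
          [/\ mutually_independent U,
              forall i x, cdf (U i) x = (F t x)%:E
            & forall B : set (n.-tuple R), measurable B ->
                P ([set w | N t w = n] `&` arrival_tuple T n @^-1` B)
                = count_prob P N t n * Q (order_statistics U @^-1` B)]].

Definition has_density (R : realType) (F f : R -> R) : Prop :=
  [/\ measurable_fun [set: R] f,
      forall x, (0 <= f x)%R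
    & forall x, (F x)%:E = \int[lebesgue_measure]_(y in `]-oo, x]) (f y)%:E].

Definition process_sigma d (Om : measurableType d) (R : realType)
  (N : R -> Om -> nat) : set (set Om) :=
  <<s [set A | exists (s : R) (k : nat),
         (0 <= s)%R /\ A = [set w | N s w = k]] >>.

(* kappa is a version, on {T_i < +oo}, of the conditional distribution of X_i
   given the whole process N. *)
Definition depends_via_last_arrivals d (Om : measurableType d) (R : realType)
  (P : probability Om R) (T : nat -> Om -> \bar R) (N : R -> Om -> nat)
  (X : nat -> {RV P >-> R}) : Prop :=
  forall i : nat, (1 <= i)%N ->
    exists kappa : R.-pker (R * R)%type ~> R,
      forall (A : set Om) (B : set R), process_sigma N A -> measurable B ->
        P (A `&` occurs T i `&` X i @^-1` B)
        = \int[P]_(w in A `&` occurs T i) kappa (arrival_pair T i w) B.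

(* m is a version of the regression function y |-> E[X | Y = y] for Y living on
   the event D. It is determined up to a null set of the law of Y on D as soon
   as the negative part of X is integrable on D. *)
Definition regression d (Om : measurableType d) (R : realType)
  (P : probability Om R) d' (E : measurableType d') (D : set Om)
  (X : Om -> R) (Y : Om -> E) (m : E -> \bar R) : Prop :=
  measurable_fun [set: E] m /\
  forall B : set E, measurable B ->
    \int[P]_(w in D `&` Y @^-1` B) (X w)%:E
    = \int[P]_(w in D `&` Y @^-1` B) m (Y w).

(* Main.v *)
From HB Require Import structures.
Require Import Defs.
From mathcomp Require Import all_boot all_order all_algebra.
From mathcomp Require Import all_classical all_reals all_analysis.
From mathcomp Require Import measurable_realfun ring.
Import Order.TTheory GRing.Theory Num.Theory.
Import numFieldNormedType.Exports.

Local Open Scope classical_set_scope.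
Local Open Scope ring_scope.
Local Open Scope ereal_scope.

(** Splitting the probability space along the events [N t = n] reduces the
    formula to the computation of the integral of X_i over [N t = n], for
    1 <= i <= n. Two facts give it.

    First, X_i may be replaced by the regression function m_i(T_(i-1), T_i) on
    every event of the process, although a regression function only knows the
    events of the sigma-algebra of (T_(i-1), T_i). Indeed the conditional law of
    X_i given the process is a kernel applied to (T_(i-1), T_i); the mean of that
    kernel represents X_i on all events of the process, so in particular it is a
    regression function, hence almost everywhere equal to m_i
    (integral_regression).

    Second, on [N t = n] the pair (T_(i-1), T_i) has the expected density
    (ge0_integral_arrival_pair). Since T_(i-1) < T_i, its law lives in the half
    plane u < v, where a finite measure is determined by its values on the
    quadrants u <= x, v > y with x <= y (half_plane_measure_unique). Such a
    quadrant is the easy one for order statistics: the a-th one is at most x and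
    the next one exceeds y exactly when a of the n variables are at most x and
    all the others exceed y, so its probability is the binomial expression
    C(n, a) F(x)^a (1 - F(y))^(n-a) (prob_order_statistics_gap). The integral of
    the density over the quadrant factors into integrals of F^k f and
    (1 - F)^l f, which are powers of F and 1 - F up to a constant; as f is only a
    density, this is proved by Fubini and not by differentiation
    (integral_density_power). The first arrival time is treated in the same way,
    with half-lines in place of quadrants.

    Expectations may be equal to +oo, and m_i takes values in the extended reals.
    All the integral identities are therefore proved for nonnegative functions,
    then applied to positive and negative parts; the negative parts have finite
    integrals, so that the differences can be formed inside the integrals, the
    finite sum over i and the series over n (ge0_integralB,
    triangle_integral_funeposneg, integral_partition_funeneg_lty). *)

Set Implicit Arguments.
Unset Strict Implicit.
Unset Printing Implicit Defensive.

(** * Differences, mixtures and densities *)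

Section integral_difference.
Context d (T : measurableType d) (R : realType).
Variable mu : {measure set T -> \bar R}.

(** When a has infinite integral, a <= (a - b)^+ + b shows that so has the
    positive part of a - b, while its negative part is dominated by b. *)
Lemma ge0_integralB (D : set T) (a b : T -> \bar R) : measurable D ->
  measurable_fun D a -> measurable_fun D b ->
  (forall x, D x -> 0 <= a x) -> (forall x, D x -> 0 <= b x) ->
  \int[mu]_(x in D) b x < +oo ->
  \int[mu]_(x in D) (a x - b x)
  = \int[mu]_(x in D) a x - \int[mu]_(x in D) b x.
Proof.
move=> mD ma mb a0 b0 boo.
have int_ge0 (h : T -> \bar R) : measurable_fun D h ->
    (forall x, D x -> 0 <= h x) -> \int[mu]_(x in D) h x < +oo ->
    mu.-integrable D h.
  move=> mh h0 hoo; apply/integrableP; split => //.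
  by under eq_integral => x /[!inE] xD do rewrite gee0_abs ?h0//.
have [aoo|] := ltP (\int[mu]_(x in D) a x) +oo.
  by rewrite integralB//; exact: int_ge0.
rewrite leye_eq => /eqP aoo.
have bfin : \int[mu]_(x in D) b x \is a fin_num.
  by rewrite ge0_fin_numE// integral_ge0.
rewrite aoo addye; last by case: (\int[mu]_(x in D) b x) bfin.
have mab : measurable_fun D (a \- b) by exact: emeasurable_funB.
have neg_fin : \int[mu]_(x in D) (a \- b)^\- x < +oo.
  apply: le_lt_trans boo; apply: ge0_le_integral => //.
  - exact: measurable_funeneg.
  - move=> x Dx; rewrite funenegE ge_max b0// andbT.
    move: (a0 _ Dx) (b0 _ Dx); case: (a x) => [r| |]//; case: (b x) => [s| |]//=.
    + by rewrite !lee_fin => r0 s0; rewrite opprB lerBlDr lerDl.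
    + by rewrite leNye.
have neg_fin_num : \int[mu]_(x in D) (a \- b)^\- x \is a fin_num.
  by rewrite ge0_fin_numE ?neg_fin// integral_ge0.
rewrite integralE.
suff -> : \int[mu]_(x in D) (a \- b)^\+ x = +oo.
  by rewrite addye//; case: (\int[mu]_(x in D) _ x) neg_fin_num.
have maxNy (z : \bar R) : maxe z 0 != -oo.
  by rewrite -ltNye (lt_le_trans (ltNyr 0%R))// le_max lexx orbT.
have : +oo <= \int[mu]_(x in D) ((a \- b)^\+ x + b x).
  rewrite -aoo; apply: ge0_le_integral => //.
  - by apply: emeasurable_funD => //; exact: measurable_funepos.
  - move=> x Dx; rewrite funeposE.
    move: (a0 _ Dx) (b0 _ Dx); case: (a x) => [r| |]//; case: (b x) => [s| |]//=.
    + rewrite !lee_fin -EFin_max -EFinD => r0 s0.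
      by rewrite lee_fin -lerBlDr le_max lexx.
    + by rewrite addey ?leey.
    + by rewrite addey ?leey.
rewrite leye_eq => /eqP; rewrite ge0_integralD//; last first.
  exact: measurable_funepos.
by move: bfin; case: (\int[mu]_(x in D) b x) => // r _;
  case: (\int[mu]_(x in D) _ x).
Qed.

End integral_difference.

Section integral_mixture.
Context d d' (Y : measurableType d) (Z : measurableType d') (R : realType).
Variables (mu : {measure set Y -> \bar R}) (D : set Y).
Variables (k : Y -> {measure set Z -> \bar R}) (nu : {measure set Z -> \bar R}).
Hypothesis mD : measurable D.
Hypothesis mk : forall U, measurable U -> measurable_fun [set: Y] (k ^~ U).
Hypothesis nuE : forall U, measurable U -> nu U = \int[mu]_(y in D) k y U.

Import HBNNSimple.

Let mk_int (h : Z -> \bar R) : (forall z, 0 <= h z) ->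
  measurable_fun [set: Z] h -> measurable_fun D (fun y => \int[k y]_z h z).
Proof.
move=> h0 mh; apply: measurable_funTS.
exact: measurable_fun_integral_kernel.
Qed.

Let mixture_nnsfun (h : {nnsfun Z >-> R}) :
  \int[nu]_z (h z)%:E = \int[mu]_(y in D) \int[k y]_z (h z)%:E.
Proof.
have fib (m : {measure set Z -> \bar R}) : \int[m]_z (h z)%:E
    = \sum_(r \in range h) r%:E * m (h @^-1` [set r]).
  by rewrite integralT_nnsfun sintegralE.
rewrite fib; under [RHS]eq_integral => y _ do rewrite fib.
rewrite ge0_integral_fsum//.
- apply: eq_fsbigr => r /[!inE] -[z _ <-].
  rewrite ge0_integralZl ?nuE//; last by rewrite lee_fin.
  exact/measurable_funTS/mk.
- by move=> r; apply/measurable_funeM/measurable_funTS/mk.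
- by move=> r y _; exact: nnsfun_mulemu_ge0.
Qed.

(** Integration against a mixture of measures. It specializes to densities
    (k y a multiple of a point mass), to image measures (k y a point mass) and to
    conditional laws (k y a probability kernel). *)
Lemma ge0_integral_mixture (h : Z -> \bar R) : (forall z, 0 <= h z) ->
  measurable_fun [set: Z] h ->
  \int[nu]_z h z = \int[mu]_(y in D) \int[k y]_z h z.
Proof.
move=> h0 mh; pose h_ := nnsfun_approx measurableT mh.
have h_0 n z : 0 <= (h_ n z)%:E by rewrite lee_fin.
have mh_ n : measurable_fun [set: Z] (EFin \o h_ n) by exact/measurable_EFinP.
have ndh z a b : (a <= b)%N -> (h_ a z)%:E <= (h_ b z)%:E.
  by move=> ab; rewrite lee_fin; exact/lefP/nd_nnsfun_approx.
have limE (m : {measure set Z -> \bar R}) :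
    \int[m]_z h z = limn (fun n => \int[m]_z (h_ n z)%:E).
  rewrite -monotone_convergence//; last first.
    by move=> z _ a b; exact: ndh.
  by apply: eq_integral => z _; apply/esym/cvg_lim => //; exact: cvg_nnsfun_approx.
rewrite limE; under eq_fun do rewrite mixture_nnsfun.
rewrite -monotone_convergence//.
- by apply: eq_integral => y _; rewrite limE.
- by move=> n; exact: (mk_int (h_0 n) (mh_ n)).
- by move=> n y _; exact: integral_ge0.
- move=> y _ a b ab.
  apply: ge0_le_integral; [by []| by move=> z _; exact: h_0|exact: mh_|exact: mh_|].
  by move=> z _; exact: ndh.
Qed.

End integral_mixture.

Section density_measure.
Context d (T : measurableType d) (R : realType).
Variables (mu : {measure set T -> \bar R}) (g : T -> R).
Hypothesis g0 : forall x, (0 <= g x)%R.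
Hypothesis mg : measurable_fun [set: T] g.

(** The term carries the two hypotheses, so that the measure structure below can
    be inferred from it. *)
Definition density_measure of (forall x, (0 <= g x)%R)
  & measurable_fun [set: T] g : set T -> \bar R :=
  fun A => \int[mu]_(x in A) (g x)%:E.

Let nu := density_measure g0 mg.

Let nu_set0 : nu set0 = 0. Proof. exact: integral_set0. Qed.

Let nu_ge0 A : 0 <= nu A.
Proof. by apply: integral_ge0 => x _; rewrite lee_fin. Qed.

Let nu_sigma_additive : semi_sigma_additive nu.
Proof.
move=> A mA tA mUA; rewrite /nu /density_measure ge0_integral_bigcup//.
- apply: is_cvg_ereal_nneg_natsum => n _.
  by apply: integral_ge0 => x _; rewrite lee_fin.
- exact/measurable_funTS/measurable_EFinP.
- by move=> x _; rewrite lee_fin.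
Qed.

HB.instance Definition _ :=
  isMeasure.Build _ _ _ (density_measure g0 mg) nu_set0 nu_ge0 nu_sigma_additive.

Let pointmass (x : T) : {measure set T -> \bar R} := mscale (NngNum (g0 x)) \d_x.

Lemma ge0_integral_density (h : T -> \bar R) :
  (forall x, 0 <= h x) -> measurable_fun [set: T] h ->
  \int[density_measure g0 mg]_x h x = \int[mu]_x (h x * (g x)%:E).
Proof.
move=> h0 mh.
rewrite [LHS](@ge0_integral_mixture _ _ _ _ _ mu [set: T] pointmass)//.
- apply: eq_integral => x _.
  rewrite ge0_integral_mscale//= integral_dirac// diracT mul1e.
  by rewrite muleC.
- move=> U mU; rewrite /pointmass/= /mscale/=; apply: emeasurable_funM.
    exact/measurable_EFinP.
  exact/measurable_EFinP/measurable_indic.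
- move=> U mU; rewrite /= /density_measure integral_mkcond.
  apply: eq_integral => x _; rewrite patchE /mscale/= diracE.
  by case: ifPn => _; rewrite ?mule1 ?mule0.
Qed.

End density_measure.

Section law_on.
Context d d' (T : measurableType d) (E : measurableType d') (R : realType).
Variables (mu : {measure set T -> \bar R}) (D : set T) (Y : T -> E).
Hypothesis mD : measurable D.
Hypothesis mY : measurable_fun [set: T] Y.

(** The law of Y restricted to the event D, hence of total mass mu D. The
    term carries the hypotheses for the same reason as in density_measure. *)
Definition law_on of measurable D & measurable_fun [set: T] Y
  : set E -> \bar R := fun A => mu (D `&` Y @^-1` A).

Let nu := law_on mD mY.

Let mYA A : measurable A -> measurable (D `&` Y @^-1` A).
Proof.
by move=> mA; apply: measurableI => //; rewrite -[X in measurable X]setTI; exact: mY.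
Qed.

Let nu_set0 : nu set0 = 0.
Proof. by rewrite /nu /law_on preimage_set0 setI0 measure0. Qed.

Let nu_ge0 A : 0 <= nu A. Proof. exact: measure_ge0. Qed.

Let nu_sigma_additive : semi_sigma_additive nu.
Proof.
move=> A mA tA mUA; rewrite /nu /law_on preimage_bigcup setI_bigcupr.
apply: measure_semi_sigma_additive.
- by move=> n; exact: mYA.
- move=> i j _ _ [w [[_ Ai] [_ Aj]]]; apply: tA => //.
  by exists (Y w).
- by rewrite -setI_bigcupr -preimage_bigcup; exact: mYA.
Qed.

HB.instance Definition _ :=
  isMeasure.Build _ _ _ (law_on mD mY) nu_set0 nu_ge0 nu_sigma_additive.

Lemma ge0_integral_law_on (h : E -> \bar R) :
  (forall x, 0 <= h x) -> measurable_fun [set: E] h ->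
  \int[law_on mD mY]_x h x = \int[mu]_(w in D) h (Y w).
Proof.
move=> h0 mh.
rewrite [LHS](@ge0_integral_mixture _ _ _ _ _ mu D (fun w => \d_(Y w)))//.
- by apply: eq_integral => w _; rewrite integral_dirac// diracT mul1e.
- move=> U mU; apply/measurable_EFinP.
  exact: (measurableT_comp (measurable_indic mU)).
- move=> U mU; rewrite /= /law_on setIC -integral_indic//.
  by rewrite -[X in measurable X]setTI; exact: mY.
Qed.

End law_on.

(** * Powers of a distribution function *)

Section density_powers.
Context (R : realType).
Notation leb := (@lebesgue_measure R).
Variables (r : rel R) (f G : R -> R).
Hypothesis r_trans : transitive r.
Hypothesis r_total : forall x y, x != y -> ~~ r x y = r y x.
Hypothesis mr : measurable_fun [set: R * R] (fun p => r p.1 p.2).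
Hypothesis f0 : forall x, (0 <= f x)%R.
Hypothesis mf : measurable_fun [set: R] f.
Hypothesis G0 : forall x, (0 <= G x)%R.
Hypothesis mG : measurable_fun [set: R] G.
Hypothesis GE : forall x, \int[leb]_u ((r u x)%:R * f u)%:E = (G x)%:E.

Let mrl x : measurable_fun [set: R] (fun u => (r u x)%:R : R).
Proof.
apply: (@measurableT_comp _ _ _ _ _ _ (fun b : bool => b%:R : R)) => //.
exact: (measurable_fun_pair1 _ mr).
Qed.

Let mrr : measurable_fun [set: R * R] (fun p => (r p.1 p.2)%:R : R).
Proof. exact: (@measurableT_comp _ _ _ _ _ _ (fun b : bool => b%:R : R)). Qed.

(** G is the mass that the density f gives to the points before x for the order
    r, so G ^+ k.+1 is formally a primitive of k.+1 * G ^+ k * f. Taking r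
    to be <= gives a distribution function, and > gives its complement. By
    induction, G x ^+ k.+2 is a double integral over pairs (u, v) of points before
    x; the pairs with u before v contribute k.+1 times the integral of
    G ^+ k.+1 * f, and the pairs with v before u contribute it once. *)
Lemma integral_density_power (k : nat) (x : R) :
  \int[leb]_u ((r u x)%:R * (k.+1%:R * G u ^+ k * f u))%:E = (G x ^+ k.+1)%:E.
Proof.
elim: k x => [|k IHk] x.
  by rewrite expr1 -GE; apply: eq_integral => u _; rewrite expr0 !mul1r.
pose phi u : R := (k.+1%:R * G u ^+ k * f u)%R.
have phi0 u : (0 <= phi u)%R by rewrite !mulr_ge0 ?exprn_ge0.
have mphi : measurable_fun [set: R] phi.
  by apply: measurable_funM => //; apply: measurable_funM => //; exact: measurable_funX.
pose a u : R := ((r u x)%:R * f u)%R.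
pose b v : R := ((r v x)%:R * phi v)%R.
have mrM (h : R -> R) y : measurable_fun [set: R] h ->
    measurable_fun [set: R] (fun u => ((r u y)%:R * h u)%:E).
  move=> mh; apply/measurable_EFinP; exact: measurable_funM (mrl y) mh.
have a0 u : (0 <= a u)%R by rewrite mulr_ge0.
have b0 u : (0 <= b u)%R by rewrite mulr_ge0.
have ma : measurable_fun [set: R] a by exact: measurable_funM.
have mb : measurable_fun [set: R] b by exact: measurable_funM.
have mab : measurable_fun [set: R * R] (fun p => a p.1 * b p.2)%R.
  by apply: measurable_funM; exact: measurableT_comp.
pose H1 p : \bar R := ((r p.1 p.2)%:R * (a p.1 * b p.2))%:E.
pose H2 p : \bar R := ((~~ r p.1 p.2)%:R * (a p.1 * b p.2))%:E.
have H10 p : 0 <= H1 p by rewrite lee_fin mulr_ge0// mulr_ge0.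
have H20 p : 0 <= H2 p by rewrite lee_fin mulr_ge0// mulr_ge0.
have mH1 : measurable_fun [set: R * R] H1.
  by apply/measurable_EFinP; exact: measurable_funM.
have mH2 : measurable_fun [set: R * R] H2.
  apply/measurable_EFinP; apply: measurable_funM => //.
  exact: (@measurableT_comp _ _ _ _ _ _ (fun b : bool => (~~ b)%:R : R)).
transitivity (\int[leb]_v \int[leb]_u (H1 (u, v) + H2 (u, v))).
  transitivity (\int[leb]_v (\int[leb]_u H1 (u, v) + \int[leb]_u H2 (u, v))).
    rewrite ge0_integralD//; first last.
    - exact: measurable_fun_fubini_tonelli_G.
    - by move=> v _; exact: integral_ge0.
    - exact: measurable_fun_fubini_tonelli_G.
    - by move=> v _; exact: integral_ge0.
    rewrite -(@fubini_tonelli _ _ _ _ _ leb leb H2)//.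
    have -> : \int[leb]_v \int[leb]_u H1 (u, v)
        = \int[leb]_v ((r v x)%:R * (k.+1%:R * G v ^+ k.+1 * f v))%:E.
      apply: eq_integral => v _.
      transitivity (\int[leb]_u ((b v)%:E * ((r u v)%:R * f u)%:E)).
        apply: eq_integral => u _; rewrite /H1/= -EFinM /a; congr EFin.
        rewrite /b; have [rvx|] := boolP (r v x); last by rewrite !(mul0r,mulr0).
        have [ruv|] := boolP (r u v); last by rewrite !(mul0r,mulr0).
        by rewrite (r_trans ruv rvx)/=; ring.
      rewrite ge0_integralZl//.
      - rewrite GE -EFinM /b /phi; congr EFin.
        by rewrite exprS; ring.
      - exact: mrM.
      - by move=> u _; rewrite lee_fin mulr_ge0.
      - by rewrite lee_fin.
    have -> : \int[leb]_u \int[leb]_v H2 (u, v)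
        = \int[leb]_u ((r u x)%:R * (G u ^+ k.+1 * f u))%:E.
      apply: eq_integral => u _.
      transitivity (\int[leb]_v ((a u)%:E * ((r v u)%:R * phi v)%:E)).
        apply: ge0_ae_eq_integral => //.
        - exact: (measurable_fun_pair2 _ mH2).
        - by apply: measurable_funeM; exact: (mrM phi u mphi).
        - move=> v _; apply: mule_ge0; first by rewrite lee_fin.
          by rewrite lee_fin; apply: mulr_ge0.
        (* the order is total only off the diagonal, which is negligible *)
        exists [set u]; split => //; first exact: lebesgue_measure_set1.
        move=> v /= h; apply: contrapT => /eqP uv; apply: h => _.
        rewrite /H2/= r_total 1?eq_sym//; rewrite -EFinM /a /b; congr EFin.
        have [rux|] := boolP (r u x); last by rewrite !(mul0r,mulr0).
        have [rvu|] := boolP (r v u); last by rewrite !(mul0r,mulr0).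
        by rewrite (r_trans rvu rux)/=; ring.
      rewrite ge0_integralZl//.
      - by rewrite IHk -EFinM /a; congr EFin; ring.
      - exact: mrM.
      - by move=> v _; rewrite lee_fin mulr_ge0.
      - by rewrite lee_fin.
    rewrite -ge0_integralD//.
    - apply: eq_integral => u _; rewrite -EFinD; congr EFin.
      by rewrite (natrD _ 1 k.+1); ring.
    - by move=> u _; rewrite lee_fin !mulr_ge0 ?exprn_ge0.
    - apply: mrM; apply: measurable_funM => //; apply: measurable_funM => //.
      exact: measurable_funX.
    - by move=> u _; rewrite lee_fin !mulr_ge0 ?exprn_ge0.
    - by apply: mrM; apply: measurable_funM => //; exact: measurable_funX.
  apply: eq_integral => v _; rewrite ge0_integralD//.
  - exact: (measurable_fun_pair1 _ mH1).
  - exact: (measurable_fun_pair1 _ mH2).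
transitivity (\int[leb]_v ((G x)%:E * (b v)%:E)).
  apply: eq_integral => v _.
  transitivity (\int[leb]_u ((b v)%:E * (a u)%:E)).
    apply: eq_integral => u _; rewrite -EFinD -EFinM; congr EFin => /=.
    by case: (r u v) => /=; ring.
  rewrite ge0_integralZl//.
  - by rewrite GE muleC.
  - exact/measurable_EFinP.
  - by move=> u _; rewrite lee_fin.
  - by rewrite lee_fin.
rewrite ge0_integralZl//.
- by rewrite IHk -EFinM -exprS.
- exact/measurable_EFinP.
- by move=> u _; rewrite lee_fin.
- by rewrite lee_fin.
Qed.

End density_powers.

(** * Order statistics *)

Lemma sorted_lt_nth_count (R : realDomainType) (s : seq R) (x y0 : R) (i : nat) :
  sorted <=%R s -> (i < size s)%N ->
  (x < nth y0 s i)%R = (count (<= x)%R s <= i)%N.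
Proof.
elim: s i => [//|z s IHs] i /= zs; have ss := path_sorted zs.
have zmin : all (>= z)%R s by apply: order_path_min zs => ? ? ?; exact: le_trans.
have [xz|zx] := ltP x z.
  have /eqP -> : count (<= x)%R s == 0%N.
    rewrite -leqn0 leqNgt -has_count; apply/hasPn => u us /=.
    by rewrite -ltNge (lt_le_trans xz)// (allP zmin).
  case: i => [|i] //= si.
  by rewrite (lt_le_trans xz)// (allP zmin)// mem_nth.
by case: i => [|i] /= si; [rewrite ltNge zx|rewrite add1n ltnS IHs].
Qed.

Section order_statistics_counting.
Context d (Om : measurableType d) (R : realType) (Q : probability Om R).
Variables (n : nat) (U : 'I_n -> {RV Q >-> R}).
Local Notation os := (order_statistics (fun i => U i : Om -> R)).

Definition below_set (x : R) (w : Om) : {set 'I_n} := [set i | (U i w <= x)%R].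

Lemma order_statistics_gt (x : R) (i : 'I_n) (w : Om) :
  (x < tnth (os w) i)%R = (#|below_set x w| <= i)%N.
Proof.
rewrite (tnth_nth 0%R) /= sorted_lt_nth_count ?size_sort ?size_tuple//.
  rewrite count_sort count_map /below_set cardsE cardE -size_filter enumT.
  by congr (_ <= _)%N.
by apply: sort_sorted; exact: le_total.
by rewrite card_ord.
Qed.

(** At least j variables are at most x and at most j are at most y, so for
    x <= y no variable can lie in between. *)
Lemma order_statistics_gap (x y : R) (i j : 'I_n) (w : Om) :
  j = i.+1 :> nat -> (x <= y)%R ->
  ((tnth (os w) i <= x) && (y < tnth (os w) j))%R
  = (#|below_set x w| == j :> nat) && (below_set x w == below_set y w).
Proof.
move=> ij xy; rewrite leNgt !order_statistics_gt -ltnNge -ij.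
have sub : below_set x w \subset below_set y w.
  by apply/fintype.subsetP => k; rewrite !inE => /le_trans; exact.
apply/andP/andP => [[jx yj]|[/eqP jx /eqP <-]]; last by rewrite jx.
have -> : below_set x w = below_set y w.
  by apply/eqP; rewrite eqEcard sub (leq_trans yj).
by split => //; rewrite eqn_leq yj (leq_trans jx)// subset_leq_card.
Qed.

Variable F : R -> R.
Hypothesis hU : mutually_independent U.
Hypothesis hF : forall i x, cdf (U i) x = (F x)%:E.

Let mU i B : measurable B -> measurable (U i @^-1` B).
Proof. by move=> mB; rewrite -[X in measurable X]setTI; exact: measurable_funP. Qed.

Lemma prob_gt (i : 'I_n) (y : R) : Q (U i @^-1` `]y, +oo[) = (1 - F y)%:E.
Proof.
have -> : U i @^-1` `]y, +oo[ = ~` (U i @^-1` `]-oo, y]).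
  by rewrite -setCitvl.
rewrite probability_setC; last exact: mU.
by have := hF i y; rewrite /cdf /distribution /pushforward => ->; rewrite -EFinB.
Qed.

Let side (x y : R) (S : {set 'I_n}) (i : 'I_n) : set R :=
  if i \in S then `]-oo, x]%classic else `]y, +oo[%classic.

Let mside x y S i : measurable (side x y S i).
Proof. by rewrite /side; case: ifP. Qed.

Lemma prob_separation (x y : R) (S : {set 'I_n}) :
  Q [set w | forall i, side x y S i (U i w)]
  = (F x ^+ #|S| * (1 - F y) ^+ (n - #|S|))%:E.
Proof.
rewrite hU//; transitivity (\prod_(i < n) (if i \in S then F x else (1 - F y)%R)%:E).
  apply: eq_bigr => i _; rewrite /side; case: ifP => _; first exact: (hF i x).
  exact: prob_gt.
rewrite -(big_morph _ EFinM (erefl 1))%E; congr EFin.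
rewrite (bigID (mem S))/=; congr (_ * _)%R.
  by rewrite -prodr_const; apply: eq_bigr => i ->.
rewrite (eq_bigr (fun=> 1 - F y)%R); last by move=> i /negbTE ->.
rewrite prodr_const; congr (_ ^+ _)%R.
have := cardC S; rewrite card_ord => /(congr1 (subn^~ #|S|)).
by rewrite addKn => <-; apply: eq_card => i; rewrite !inE.
Qed.

Lemma separation_below_set (x y : R) (S : {set 'I_n}) (w : Om) : (x <= y)%R ->
  (forall i, side x y S i (U i w))
  <-> below_set x w = S /\ below_set y w = S.
Proof.
move=> xy; rewrite /side; split => [h|[hx hy] i].
  have hS i : i \in S -> (U i w <= x)%R.
    by move=> iS; have := h i; rewrite iS/= in_itv.
  have hCS i : i \notin S -> (y < U i w)%R.
    by move=> /negbTE iS; have := h i; rewrite iS/= in_itv/= andbT.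
  split; apply/finset.setP => i; rewrite !inE.
    apply/idP/idP => [|/hS//]; apply: contraLR => /hCS.
    by rewrite -ltNge; exact: le_lt_trans.
  apply/idP/idP => [|/hS /le_trans]; last exact.
  by apply: contraLR => /hCS; rewrite -ltNge.
case: ifPn => iS; rewrite /= in_itv/=.
  by move: iS; rewrite -hx inE.
by move: iS; rewrite -hy inE andbT -ltNge.
Qed.

(** The event is the disjoint union, over the sets S of j indices, of the events
    on which the variables of S are at most x and the others exceed y. *)
Lemma prob_order_statistics_gap (x y : R) (i j : 'I_n) :
  j = i.+1 :> nat -> (x <= y)%R ->
  Q [set w | (tnth (os w) i <= x)%R /\ (y < tnth (os w) j)%R]
  = ('C(n, j)%:R * (F x ^+ j * (1 - F y) ^+ (n - j)))%:E.
Proof.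
move=> ij xy.
pose I : set {set 'I_n} := [set` [pred S : {set 'I_n} | #|S| == j]].
pose E (S : {set 'I_n}) := [set w | forall i, side x y S i (U i w)].
have -> : [set w | (tnth (os w) i <= x)%R /\ (y < tnth (os w) j)%R]
    = \bigcup_(S in I) E S.
  apply/seteqP; split => [w /= /andP|w [S /= Sj /(separation_below_set _ _ xy)[hx hy]]].
    rewrite (order_statistics_gap _ ij xy) => /andP[hj /eqP hxy].
    by exists (below_set x w) => //; apply/separation_below_set.
  by apply/andP; rewrite (order_statistics_gap _ ij xy) hx hy eqxx andbT.
have mE S : measurable (E S).
  rewrite (_ : E S = \bigcap_(i in setT) (U i @^-1` side x y S i)).
    by apply: fin_bigcap_measurable => // k _; exact: mU.
  by apply/seteqP; split => [w h k _|w h k]; exact: h.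
rewrite measure_fin_bigcup//; first last.
  by move=> S S' _ _ [w [/(separation_below_set _ _ xy)[<- _]
    /(separation_below_set _ _ xy)[<- _]]].
  exact: finite_finset.
transitivity (\sum_(S : {set 'I_n} | #|S| == j) Q (E S)).
  apply/esym/bigfs; first exact: index_enum_uniq.
  by move=> S _; rewrite mem_index_enum.
rewrite (eq_bigr (fun=> (F x ^+ j * (1 - F y) ^+ (n - j))%:E)); last first.
  by move=> S /eqP Sj; rewrite prob_separation Sj.
rewrite sumEFin; congr EFin.
rewrite sumr_const -[LHS]mulr_natl; congr (_%:R * _)%R.
have := card_draws 'I_n j; rewrite card_ord => <-.
by rewrite -sum1_card -[RHS]sum1_card; apply: eq_bigl => S; rewrite !inE.
Qed.

(** The degenerate case of the separation in which no variable is at most y. *)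
Lemma prob_order_statistics_min (y : R) (i : 'I_n) : i = 0%N :> nat ->
  Q [set w | (y < tnth (os w) i)%R] = ((1 - F y) ^+ n)%:E.
Proof.
move=> i0.
have -> : [set w | (y < tnth (os w) i)%R]
    = [set w | forall k, side y y finset.set0 k (U k w)].
  apply/seteqP; split => w /=; rewrite order_statistics_gt i0 leqn0 cards_eq0.
    by move=> /eqP h; apply/separation_below_set.
  by move=> /(separation_below_set _ _ (lexx y))[->].
by rewrite prob_separation cards0 expr0 mul1r subn0.
Qed.

End order_statistics_counting.

(** * Measures on the half plane u < v *)

Section half_plane.
Context (R : realType).

Definition quadrant (x y : R) : set (R * R) :=
  [set p | (p.1 <= x)%R /\ (y < p.2)%R].

Definition quadrants : set (set (R * R)) :=
  [set A | exists x y : R, A = quadrant x y].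

Lemma quadrantI (x y x' y' : R) :
  quadrant x y `&` quadrant x' y' = quadrant (Num.min x x') (Num.max y y').
Proof.
apply/seteqP; split => p; rewrite /quadrant/= le_min gt_max.
  by move=> [[-> ->] [-> ->]].
by move=> [/andP[-> ->] /andP[-> ->]].
Qed.

Lemma measurable_quadrant (x y : R) : measurable (quadrant x y).
Proof.
have -> : quadrant x y = `]-oo, x]%classic `*` `]y, +oo[%classic.
  by apply/seteqP; split => p; rewrite /quadrant/= !in_itv/= andbT.
exact: measurableX.
Qed.

Lemma measurable_quadrantsE : @measurable _ (R * R)%type = <<s quadrants >>.
Proof.
apply/seteqP; split => [A mA|A]; last first.
  apply: smallest_sub => [|B [x [y ->]]]; last exact: measurable_quadrant.
  exact: sigma_algebra_measurable.
pose T := g_sigma_algebraType quadrants.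
have mQ x y : @measurable _ T (quadrant x y).
  by apply: sub_sigma_algebra; exists x, y.
suff mid : measurable_fun [set: T] (id : T -> R * R).
  by have := mid measurableT _ mA; rewrite setTI.
have bnd (z : R) : exists n : nat, (- n%:R < z)%R /\ (z <= n%:R)%R.
  exists (Num.truncn `|z|).+1; have zn := truncnS_gt `|z|.
  by rewrite ltrNl (le_lt_trans (ler_norm _)) ?normrN// (le_trans (ler_norm _))// ltW.
apply/measurable_fun_pairP; split.
- apply: (measurability _ (RGenOInfty.measurableE R)) => _ [_ [x ->] <-].
  rewrite setTI -setCitvl; apply: (@measurableC _ T (_ @^-1` `]-oo, x])).
  rewrite (_ : _ @^-1` _ = \bigcup_n quadrant x (- n%:R)).
    by apply: bigcupT_measurable => n; exact: mQ.
  apply/seteqP; split => [p /=|p [n _ [/= px _]]]; rewrite in_itv//= => px.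
  by have [n [np _]] := bnd p.2; exists n.
- apply: (measurability _ (RGenOInfty.measurableE R)) => _ [_ [y ->] <-].
  rewrite setTI.
  rewrite (_ : _ @^-1` _ = \bigcup_n quadrant n%:R y).
    by apply: bigcupT_measurable => n; exact: mQ.
  apply/seteqP; split => [p /=|p [n _ [/= _ py]]]; rewrite in_itv/= andbT// => py.
  by have [n [_ np]] := bnd p.1; exists n.
Qed.

Variables mu nu : {measure set (R * R) -> \bar R}.
Hypothesis mu_fin : mu [set: R * R] < +oo.
Hypothesis mu_nu : forall x y, (x <= y)%R -> mu (quadrant x y) = nu (quadrant x y).

(** Intersecting an arbitrary quadrant with quadrant q q gives one whose corner
    (x, y) satisfies x <= q <= y. Hence the restrictions of the two measures to
    quadrant q q agree on all quadrants, which generate the Borel sets. *)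
Let eq_on_quadrant (q : R) (A : set (R * R)) : measurable A ->
  A `<=` quadrant q q -> mu A = nu A.
Proof.
move=> mA Aq; have mq := measurable_quadrant q q.
rewrite -(setIidl Aq).
apply: (measure_unique quadrants (fun n => quadrant n%:R (- n%:R))
  measurable_quadrantsE _ _ _ (mrestr mu mq) (mrestr nu mq)) => //.
- move=> _ _ [x [y ->]] [x' [y' ->]]; rewrite quadrantI.
  by eexists; eexists; reflexivity.
- by move=> n; exists n%:R, (- n%:R)%R.
- apply/seteqP; split => // p _.
  pose z : R := (Num.max `|p.1| `|p.2|)%R.
  exists (Num.truncn z).+1 => //; have zn := truncnS_gt z.
  have [p1 p2] : (`|p.1| < (Num.truncn z).+1%:R /\ `|p.2| < (Num.truncn z).+1%:R)%R.
    by move: zn; rewrite {1}/z gt_max => /andP[].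
  split; first exact: le_trans (ler_norm _) (ltW p1).
  by rewrite ltrNl (le_lt_trans (ler_norm _))// normrN.
- move=> _ [x [y ->]]; rewrite /= /mrestr quadrantI; apply: mu_nu.
  by rewrite ge_min !le_max !lexx !orbT.
- move=> n; apply: le_lt_trans mu_fin; rewrite /= /mrestr.
  apply: le_measure; rewrite ?inE//.
  by apply: measurableI => //; exact: measurable_quadrant.
Qed.

(** If u < v then u <= q < v for some rational q: the half plane is a countable
    union of the quadrants with corner (q, q). *)
Lemma half_plane_measure_unique (A : set (R * R)) : measurable A ->
  A `<=` [set p | (p.1 < p.2)%R] -> mu A = nu A.
Proof.
move=> mA A12.
pose E (k : nat) : set (R * R) :=
  if unpickle k is Some q then quadrant (ratr q) (ratr q) else set0.
have mE k : measurable (E k).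
  by rewrite /E; case: unpickle => // q; exact: measurable_quadrant.
have AE : A = \bigcup_k (A `&` seqDU E k).
  rewrite -setI_bigcupr -seqDU_bigcup_eq; apply/esym/setIidl => p /A12 /=.
  move=> /rat_in_itvoo[q]; rewrite in_itv/= => /andP[pq qp].
  by exists (pickle q); [exact: I|rewrite /E pickleK; split; [exact: ltW|]].
have mAE k : measurable (A `&` seqDU E k).
  by apply: measurableI => //; apply: measurableD => //; exact: bigsetU_measurable.
have tAE : trivIset setT (fun k => A `&` seqDU E k).
  exact/trivIset_setIl/trivIset_seqDU.
rewrite AE !measure_bigcup//; apply: eq_eseriesr => k _.
have AEk : A `&` seqDU E k `<=` E k by move=> p [_ []].
case Eq : (unpickle k) => [q|]; last first.
  have -> : A `&` seqDU E k = set0.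
    by rewrite -subset0; move: AEk; rewrite {2}/E Eq.
  by rewrite !measure0.
by apply: (@eq_on_quadrant (ratr q)) => //; move: AEk; rewrite {2}/E Eq.
Qed.

End half_plane.

(** * Densities of distribution functions *)

Lemma cumulative01_bounds (R : realType) (F : cumulativeBounded (0 : R) (1 : R)) x :
  (0 <= F x <= 1)%R.
Proof.
have Fnd : {homo F : x y / (x <= y)%R} by exact: cumulative_is_nondecreasing.
apply/andP; split.
  apply: (cvgr_to_le (cumulativeNy F)); near=> y; apply: Fnd.
  by near: y; exact: nbhs_ninfty_le.
apply: (cvgr_to_ge (cumulativey F)); near=> y; apply: Fnd.
by near: y; exact: nbhs_pinfty_ge.
Unshelve. all: by end_near. Qed.

Section density_of_cdf.
Context (R : realType).
Notation leb := (@lebesgue_measure R).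
Variables (F f : R -> R) (t : R).
Hypothesis Fnd : {homo F : x y / (x <= y)%R}.
Hypothesis F01 : forall x, (0 <= F x <= 1)%R.
Hypothesis Ft : F t = 1%R.
Hypothesis hf : has_density F f.

Let mf : measurable_fun [set: R] f. Proof. by case: hf. Qed.
Let f0 x : (0 <= f x)%R. Proof. by case: hf. Qed.
Let F0 x : (0 <= F x)%R. Proof. by have /andP[] := F01 x. Qed.
Let Fc0 x : (0 <= 1 - F x)%R. Proof. by rewrite subr_ge0; have /andP[] := F01 x. Qed.
Let mF : measurable_fun [set: R] F. Proof. exact: nondecreasing_measurable. Qed.
Let mFc : measurable_fun [set: R] (fun x => 1 - F x)%R.
Proof. exact: measurable_funB. Qed.

(** The intervals up to t + n have mass F (t + n) = 1, and they exhaust the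
    line. *)
Lemma integral_density_setT : \int[leb]_x (f x)%:E = 1.
Proof.
pose nu : {measure set _ -> \bar R} := density_measure leb f0 mf.
pose I (n : nat) : set R := `]-oo, (t + n%:R)%R]%classic.
have mI n : measurable (I n) by exact: measurable_itv.
have : nu (I n) @[n --> \oo] --> nu (\bigcup_n I n).
  apply: nondecreasing_cvg_mu => //; first exact: (bigcupT_measurable _ mI).
  move=> m n mn; apply/subsetPset/subset_itvl.
  by rewrite bnd_simp lerD2l ler_nat.
have -> : \bigcup_n I n = [set: R].
  apply/seteqP; split => // x _; exists (Num.truncn `|x - t|%R).+1 => //=.
  rewrite /I/= in_itv/= -lerBlDl (le_trans (ler_norm _))// ltW//.
  exact: truncnS_gt.
rewrite (_ : (fun n => _) = cst 1); last first.
  apply/funext => n; rewrite /nu/= /density_measure.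
  have [_ _ <-] := hf; congr EFin.
  have tn : (t <= t + n%:R)%R by rewrite lerDl.
  apply/eqP; rewrite eq_le (andP (F01 _)).2/=.
  by have := Fnd tn; rewrite Ft.
by move=> /cvg_lim => /(_ (@ereal_hausdorff _)); rewrite lim_cst.
Qed.

Lemma integral_density_le x :
  \int[leb]_u ((u <= x)%R%:R * f u)%:E = (F x)%:E.
Proof.
have [_ _ ->] := hf; rewrite [RHS]integral_mkcond; apply: eq_integral => u _.
rewrite patchE; case: ifPn; rewrite ?notin_setE ?inE/= in_itv/=.
  by move=> ->; rewrite mul1r.
by move=> /negP/negbTE ->; rewrite mul0r.
Qed.

Lemma integral_density_gt x :
  \int[leb]_u ((x < u)%R%:R * f u)%:E = (1 - F x)%:E.
Proof.
have mbool (b : R -> bool) : measurable_fun [set: R] b ->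
    measurable_fun [set: R] (fun u => ((b u)%:R * f u)%:E).
  move=> mb; apply/measurable_EFinP; apply: measurable_funM => //.
  exact: (@measurableT_comp _ _ _ _ _ _ (fun b : bool => b%:R : R)).
have h : \int[leb]_u ((u <= x)%R%:R * f u)%:E + \int[leb]_u ((x < u)%R%:R * f u)%:E = 1.
  rewrite -ge0_integralD//.
  - rewrite -integral_density_setT; apply: eq_integral => u _.
    by rewrite -EFinD -mulrDl ltNge; case: (u <= x)%R; rewrite ?addr0 ?add0r mul1r.
  - by move=> u _; rewrite lee_fin mulr_ge0.
  - by apply: mbool; exact: measurable_fun_ler.
  - by move=> u _; rewrite lee_fin mulr_ge0.
  - by apply: mbool; exact: measurable_fun_ltr.
by move: h; rewrite integral_density_le EFinB => <-; rewrite addeAC subee ?add0e.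
Qed.

Lemma integral_cdf_power k x :
  \int[leb]_u ((u <= x)%R%:R * (k.+1%:R * F u ^+ k * f u))%:E = (F x ^+ k.+1)%:E.
Proof.
apply: (@integral_density_power R (fun u v => u <= v)%R) => //.
- exact: le_trans.
- by move=> u v uv; rewrite -ltNge lt_neqAle eq_sym uv.
- exact: measurable_fun_ler.
- exact: integral_density_le.
Qed.

Lemma integral_ccdf_power k x :
  \int[leb]_u ((x < u)%R%:R * (k.+1%:R * (1 - F u) ^+ k * f u))%:E
  = ((1 - F x) ^+ k.+1)%:E.
Proof.
apply: (@integral_density_power R (fun u v => v < u)%R f (fun x => 1 - F x)%R) => //.
- by move=> u v w uv vw; exact: lt_trans vw uv.
- by move=> u v uv; rewrite -leNgt le_eqVlt (negbTE uv).
- exact: measurable_fun_ltr.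
- exact: integral_density_gt.
Qed.

(** Up to a factorial constant, the joint density of two consecutive order
    statistics among k + l + 2 variables, with k of them below the first one and
    l above the second one. *)
Definition gap_density (k l : nat) (p : R * R) : R :=
  (f p.1 * f p.2 * F p.1 ^+ k * (1 - F p.2) ^+ l)%R.

Lemma gap_density_ge0 k l p : (0 <= gap_density k l p)%R.
Proof. by rewrite !mulr_ge0 ?exprn_ge0. Qed.

Let m1k k : measurable_fun [set: R] (fun u => k.+1%:R * F u ^+ k * f u)%R.
Proof.
by apply: measurable_funM => //; apply: measurable_funM => //; exact: measurable_funX.
Qed.

Let m2k k : measurable_fun [set: R] (fun u => k.+1%:R * (1 - F u) ^+ k * f u)%R.
Proof.
by apply: measurable_funM => //; apply: measurable_funM => //; exact: measurable_funX.
Qed.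

Lemma measurable_gap_density k l : measurable_fun [set: R * R] (gap_density k l).
Proof.
apply: measurable_funM.
  apply: measurable_funM.
    apply: measurable_funM; first exact: (measurableT_comp mf measurable_fst).
    exact: (measurableT_comp mf measurable_snd).
  exact: measurable_funX (measurableT_comp mF measurable_fst).
exact: measurable_funX (measurableT_comp mFc measurable_snd).
Qed.

Lemma integral_gap_density_quadrant k l x y :
  \int[leb \x leb]_(p in quadrant x y) ((k.+1 * l.+1)%:R * gap_density k l p)%:E
  = (F x ^+ k.+1 * (1 - F y) ^+ l.+1)%:E.
Proof.
pose a u : R := ((u <= x)%R%:R * (k.+1%:R * F u ^+ k * f u))%R.
pose b v : R := ((y < v)%R%:R * (l.+1%:R * (1 - F v) ^+ l * f v))%R.
have a0 u : 0 <= (a u)%:E by rewrite lee_fin !mulr_ge0 ?exprn_ge0.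
have b0 u : 0 <= (b u)%:E by rewrite lee_fin !mulr_ge0 ?exprn_ge0.
have mbool (c : R -> bool) : measurable_fun [set: R] c ->
    measurable_fun [set: R] (fun u => ((c u)%:R : R)).
  by move=> mb; exact: (@measurableT_comp _ _ _ _ _ _ (fun b : bool => b%:R : R)).
have ma : measurable_fun [set: R] (EFin \o a).
  apply/measurable_EFinP; apply: measurable_funM (m1k k).
  by apply: mbool; exact: measurable_fun_ler.
have mb : measurable_fun [set: R] (EFin \o b).
  apply/measurable_EFinP; apply: measurable_funM (m2k l).
  by apply: mbool; exact: measurable_fun_ltr.
rewrite integral_mkcond.
transitivity (\int[leb \x leb]_p ((a p.1)%:E * (b p.2)%:E)).
  apply: eq_integral => -[u v] _; rewrite patchE -EFinM /a /b /gap_density/=.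
  case: ifPn; rewrite ?notin_setE ?inE /quadrant/=.
    by move=> [-> ->]; rewrite !mul1r natrM; congr EFin; ring.
  move=> uv; have [ux|ux] := leP u x; last by rewrite !mul0r.
  have [yv|yv] := ltP y v; last by rewrite !mul0r mulr0.
  by exfalso; apply: uv.
rewrite fubini_tonelli1//; last 2 first.
- apply: emeasurable_funM.
    exact: (measurableT_comp ma measurable_fst).
  exact: (measurableT_comp mb measurable_snd).
- by move=> p; exact: mule_ge0.
rewrite /fubini_F/=.
transitivity (\int[leb]_u ((a u)%:E * ((1 - F y) ^+ l.+1)%:E)).
  apply: eq_integral => u _; rewrite ge0_integralZl//.
  by rewrite integral_ccdf_power.
rewrite ge0_integralZr//.
  by rewrite integral_cdf_power.
by rewrite lee_fin exprn_ge0.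
Qed.

End density_of_cdf.

(** * Arrival times and the sigma-algebra of the process *)

Section arrivals.
Context d (Om : measurableType d) (R : realType).
Variables (T : nat -> Om -> \bar R) (N : R -> Om -> nat).
Hypothesis hTN : claim_arrivals T N.

Lemma arrival_time_ge0 i w : 0 <= T i w.
Proof.
elim: i => [|i IH]; first by rewrite (arrival0 hTN).
have [/(arrival_lt hTN) /ltW|] := ltP (T i w) +oo; first exact: le_trans.
by rewrite leye_eq => /eqP /(arrival_oo hTN) ->; rewrite leey.
Qed.

Lemma arrival_time_nd w : {homo T^~ w : i j / (i <= j)%N >-> i <= j}.
Proof.
apply: homo_leq => [x|y x z|i]; [exact: lexx|exact: le_trans|].
have [/(arrival_lt hTN) /ltW//|] := ltP (T i w) +oo.
by rewrite leye_eq => /eqP /(arrival_oo hTN) ->; rewrite leey.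
Qed.

Lemma count_geP (s : R) i w : (0 <= s)%R -> (i <= N s w)%N = (T i w <= s%:E).
Proof.
move=> s0; have [TN maxN] := arrival_count hTN w s0.
apply/idP/idP => [iN|]; last exact: maxN.
exact: le_trans (arrival_time_nd w iN) TN.
Qed.

Lemma fin_arrival_time i w : occurs T i w -> T i w = (arrival T i w)%:E.
Proof.
rewrite /occurs/= => Ti; rewrite /arrival fineK//.
by rewrite ge0_fin_numE// arrival_time_ge0.
Qed.

Lemma occurs_le i j w : (i <= j)%N -> occurs T j w -> occurs T i w.
Proof. by move=> ij; apply: le_lt_trans; exact: arrival_time_nd. Qed.

Lemma count_occurs (t : R) i w : (0 <= t)%R -> (i <= N t w)%N -> occurs T i w.
Proof. by move=> t0; rewrite count_geP// => /le_lt_trans; apply; exact: ltry. Qed.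

Lemma count_arrival_le (t : R) i w :
  (0 <= t)%R -> (i <= N t w)%N -> (arrival T i w <= t)%R.
Proof.
move=> t0 iN; have /fin_arrival_time Ti := count_occurs t0 iN.
by move: iN; rewrite count_geP// Ti lee_fin.
Qed.

Lemma arrival_ge0 i w : (0 <= arrival T i w)%R.
Proof. by rewrite /arrival fine_ge0// arrival_time_ge0. Qed.

Lemma arrival_ltS i w : occurs T i.+1 w -> (arrival T i w < arrival T i.+1 w)%R.
Proof.
move=> oS; have oi := occurs_le (leqnSn i) oS.
rewrite -lte_fin -!fin_arrival_time//; exact: (arrival_lt hTN).
Qed.

Lemma arrival0E w : arrival T 0 w = 0%R.
Proof. by rewrite /arrival (arrival0 hTN). Qed.

Lemma measurable_arrival i : measurable_fun [set: Om] (arrival T i).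
Proof. exact: (measurableT_comp (fine_measurable _) (arrival_measurable hTN i)). Qed.

Lemma measurable_arrival_pair i : measurable_fun [set: Om] (arrival_pair T i).
Proof. by apply: measurable_fun_pair; exact: measurable_arrival. Qed.

Lemma measurable_occurs i : measurable (occurs T i).
Proof.
rewrite -[X in measurable X]setTI.
exact: emeasurable_fun_infty_o (arrival_measurable hTN i) _.
Qed.

Lemma measurable_count_eq (t : R) n : (0 <= t)%R -> measurable [set w | N t w = n].
Proof.
move=> t0; have mle i : measurable [set w | T i w <= t%:E].
  rewrite -[X in measurable X]setTI.
  exact: emeasurable_fun_infty_c (arrival_measurable hTN i) _.
rewrite (_ : [set w | _] = [set w | T n w <= t%:E] `\` [set w | T n.+1 w <= t%:E]).
  exact: measurableD.
apply/seteqP; split => w /=; rewrite -!count_geP//.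
  by move=> ->; rewrite ltnn.
by move=> [nN /negP]; rewrite -ltnNge ltnS => Nn; apply/eqP; rewrite eqn_leq Nn.
Qed.

Let S := g_sigma_algebraType [set A : set Om | exists (s : R) (k : nat),
         (0 <= s)%R /\ A = [set w | N s w = k]].

Lemma process_count_ge (s : R) i :
  (0 <= s)%R -> process_sigma N [set w | (i <= N s w)%N].
Proof.
move=> s0.
rewrite (_ : [set w | _] = \bigcup_k [set w | N s w = (i + k)%N]).
  apply: (@bigcupT_measurable _ S) => k.
  by apply: sub_sigma_algebra; exists s, (i + k)%N.
apply/seteqP; split => [w /= iN|w [k _ /= ->]]; last exact: leq_addr.
by exists (N s w - i)%N => //=; rewrite subnKC.
Qed.

(** T_i <= x means that at least i claims have arrived by time x. *)
Lemma process_measurable_arrival_time i :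
  measurable_fun [set: S] (T i : S -> \bar R).
Proof.
apply: (measurability _ (ErealGenOInfty.measurableE R)) => _ [_ [x ->] <-].
rewrite setTI -[X in measurable X]setCK; apply: measurableC.
have [x0|x0] := ltP x 0%R.
  rewrite (_ : ~` _ = set0); first exact: (@measurable0 _ S).
  rewrite -subset0 => w /=; rewrite in_itv/= andbT; apply.
  by apply: lt_le_trans (arrival_time_ge0 i w); rewrite lte_fin.
rewrite (_ : ~` _ = [set w | (i <= N x w)%N]); first exact: process_count_ge.
by apply/seteqP; split => w /=; rewrite in_itv/= andbT count_geP// leNgt => /negP.
Qed.

Lemma process_measurable_pair i (B : set (R * R)) : measurable B ->
  process_sigma N (occurs T i `&` arrival_pair T i @^-1` B).
Proof.
move=> mB; apply: (@measurableI _ S).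
  have := emeasurable_fun_infty_o measurableT
    (process_measurable_arrival_time i) +oo.
  by rewrite setTI.
have mar j : measurable_fun [set: S] (arrival T j : S -> R).
  exact: (measurableT_comp (fine_measurable _) (process_measurable_arrival_time j)).
have mpair : measurable_fun [set: S] (arrival_pair T i : S -> R * R).
  by apply: measurable_fun_pair.
by have := mpair measurableT _ mB; rewrite setTI.
Qed.

Lemma process_sigma_measurable (A : set Om) : process_sigma N A -> measurable A.
Proof.
apply: smallest_sub; first exact: sigma_algebra_measurable.
by move=> _ [s [k [s0 ->]]]; exact: measurable_count_eq.
Qed.

End arrivals.

(** * Law of consecutive arrival times given the number of claims *)

Section law_of_consecutive_arrivals.
Context d (Om : measurableType d) (R : realType) (P : probability Om R).
Notation leb := (@lebesgue_measure R).
Variables (T : nat -> Om -> \bar R) (N : R -> Om -> nat).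
Variables (F : R -> cumulativeBounded (0 : R) (1 : R)) (t : R) (f : R -> R).
Hypothesis hTN : claim_arrivals T N.
Hypothesis hOS : os_point_process P T N F.
Hypothesis t_gt0 : (0 < t)%R.
Hypothesis hf : has_density (F t) f.

Let t0 : (0 <= t)%R. Proof. exact: ltW. Qed.
Let Ft : F t t = 1%R. Proof. by have [] := hOS t_gt0. Qed.
Let Fnd : {homo F t : x y / (x <= y)%R}.
Proof. exact: cumulative_is_nondecreasing. Qed.
Let F01 x : (0 <= F t x <= 1)%R. Proof. exact: cumulative01_bounds. Qed.
Let mf : measurable_fun [set: R] f. Proof. by case: hf. Qed.
Let f0 x : (0 <= f x)%R. Proof. by case: hf. Qed.

Let mN n : measurable [set w | N t w = n].
Proof. exact: (measurable_count_eq hTN). Qed.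

Lemma count_prob_fin n : exists p : R, count_prob P N t n = p%:E.
Proof.
by exists (fine (count_prob P N t n)); rewrite fineK// fin_num_measure.
Qed.

Section joint.
Variables k l : nat.
Let n := (k + l).+2.
Let i := k.+2.
Hypothesis pi_gt0 : 0 < count_prob P N t n.

Let kn : (k < n)%N. Proof. by rewrite /n ltnS leqW// leq_addr. Qed.
Let k1n : (k.+1 < n)%N. Proof. by rewrite /n !ltnS leq_addr. Qed.

Let mpair : measurable_fun [set: Om] (arrival_pair T i).
Proof. exact: (measurable_arrival_pair hTN). Qed.

Let mu : {measure set (R * R) -> \bar R} := law_on P (mN n) mpair.

Lemma law_arrival_pair_quadrant x y : (x <= y)%R ->
  mu (quadrant x y) = count_prob P N t n *
   ('C(n, k.+1)%:R * (F t x ^+ k.+1 * (1 - F t y) ^+ l.+1))%:E.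
Proof.
move=> xy; have [_ _ /(_ _ pi_gt0)[d' [Om' [Q [U [hU hF hT]]]]]] := hOS t_gt0.
pose a : 'I_n := Ordinal kn; pose b : 'I_n := Ordinal k1n.
pose B : set (n.-tuple R) :=
  [set v | (tnth v a <= x)%R /\ (y < tnth v b)%R].
have mB : measurable B.
  have mt (j : 'I_n) : measurable_fun [set: n.-tuple R] (fun v => tnth v j).
    exact: measurable_tnth.
  have -> : B = ((fun v : n.-tuple R => tnth v a) @^-1` `]-oo, x]) `&`
                ((fun v => tnth v b) @^-1` `]y, +oo[).
    by apply/seteqP; split => v /=; rewrite !in_itv/= andbT.
  apply: measurableI; rewrite -[X in measurable X]setTI; exact: mt.
transitivity (P ([set w | N t w = n] `&` arrival_tuple T n @^-1` B)).
  rewrite /mu/= /law_on; congr (P (_ `&` _)).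
  by apply/seteqP; split => w; rewrite /quadrant/B/= !tnth_mktuple.
rewrite hT//; congr (_ * _).
have := @prob_order_statistics_gap _ _ _ Q n U (F t) hU hF x y a b erefl xy.
by rewrite /= (_ : (n - k.+1)%N = l.+1)// /n subSS -addnS addKn.
Qed.

(** The strict inequality makes W lie in the open half plane, where quadrants
    determine a measure; the two others produce the integration domain. *)
Let W : set (R * R) := [set p | [/\ 0 <= p.1, p.1 < p.2 & p.2 <= t]%R].

Let mW : measurable W.
Proof.
have mle (a b : R * R -> R) : measurable_fun [set: R * R] a ->
    measurable_fun [set: R * R] b -> measurable [set p | (a p <= b p)%R].
  move=> ma mb; have /(_ measurableT [set true]) := measurable_fun_ler ma mb.
  by rewrite setTI; apply.
have mlt (a b : R * R -> R) : measurable_fun [set: R * R] a ->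
    measurable_fun [set: R * R] b -> measurable [set p | (a p < b p)%R].
  move=> ma mb; have /(_ measurableT [set true]) := measurable_fun_ltr ma mb.
  by rewrite setTI; apply.
have -> : W = [set p | (0 <= p.1)%R] `&`
    ([set p | (p.1 < p.2)%R] `&` [set p | (p.2 <= t)%R]).
  by apply/seteqP; split => p /=; [case|case=> ? []].
by apply: measurableI; [exact: mle|apply: measurableI; [exact: mlt|exact: mle]].
Qed.

Let WNn w : N t w = n -> W (arrival_pair T i w).
Proof.
move=> Nn; have iN : (i <= N t w)%N by rewrite Nn /i /n !ltnS leq_addr.
split; rewrite /arrival_pair/=.
- exact: (arrival_ge0 hTN).
- by apply: (arrival_ltS hTN); exact: (count_occurs hTN) iN.
- exact: (count_arrival_le hTN).
Qed.

(** Written in this form to match the density of order statistics; cE compares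
    it with the binomial coefficient of prob_order_statistics_gap. *)
Let c : R := (n`!%:R / (k`! * l`!)%:R)%R.

Let c_ge0 : (0 <= c)%R. Proof. by rewrite /c divr_ge0. Qed.

Let cE : c = ('C(n, k.+1)%:R * (k.+1 * l.+1)%:R)%R.
Proof.
rewrite /c; have <- : ('C(n, k.+1) * (k.+1 * l.+1) * (k`! * l`!))%N = n`!.
  have /bin_fact <- : (k.+1 <= n)%N by exact: ltnW.
  have -> : (n - k.+1)%N = l.+1 by rewrite /n subSS -addnS addKn.
  by rewrite !factS; ring.
by rewrite !natrM mulfK// -natrM pnatr_eq0 -lt0n muln_gt0 !fact_gt0.
Qed.

Let gd := gap_density (F t) f k l.
Let gd0 p : (0 <= gd p)%R. Proof. exact: (gap_density_ge0 F01 hf). Qed.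
Let mgd : measurable_fun [set: R * R] gd.
Proof. exact: (measurable_gap_density Fnd hf). Qed.

Let pi : R := fine (count_prob P N t n).
Let piE : count_prob P N t n = pi%:E.
Proof. by rewrite fineK// fin_num_measure. Qed.
Let pi0 : (0 <= pi)%R. Proof. exact: fine_ge0. Qed.

Let G p : R := (pi * c * gd p)%R.
Let G0 p : (0 <= G p)%R. Proof. by rewrite mulr_ge0// mulr_ge0. Qed.
Let mG : measurable_fun [set: R * R] G. Proof. exact: measurable_funM. Qed.

Let GW p : R := (G p * \1_W p)%R.
Let GW0 p : (0 <= GW p)%R. Proof. by rewrite mulr_ge0. Qed.
Let mGW : measurable_fun [set: R * R] GW.
Proof. by apply: measurable_funM => //; exact: measurable_indic. Qed.

(** Lebesgue measure lives on a copy of R with its own display; the identity map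
    transports its densities to R * R, where the arrival times take their
    values. *)
Let measurable_idR2 :
  measurable_fun [set: measurableTypeR R * measurableTypeR R] (id : _ -> R * R).
Proof. exact: measurable_id. Qed.

Let plane_density (g : R * R -> R) (g0 : forall p, (0 <= g p)%R)
    (mg : measurable_fun [set: R * R] g) : {measure set (R * R) -> \bar R} :=
  law_on (density_measure (leb \x leb) g0 mg) measurableT measurable_idR2.

Let plane_densityE g g0 mg A :
  @plane_density g g0 mg A = \int[leb \x leb]_(p in A) (g p)%:E.
Proof. by rewrite /plane_density/= /law_on setTI. Qed.

Let law_density (A : set (R * R)) : measurable A ->
  mu A = plane_density GW0 mGW A.
Proof.
move=> mA; have -> : mu A = mu (A `&` W).
  rewrite /mu/= /law_on; congr (P _); apply/seteqP; split => w /= [Nn Aw].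
    by split => //; split => //; exact: WNn.
  by split => //; case: Aw.
rewrite (@half_plane_measure_unique _ mu (plane_density G0 mG)).
- rewrite !plane_densityE integral_mkcondr.
  by apply: eq_integral => p _; rewrite epatch_indic/= -EFinM.
- rewrite /mu/= /law_on (le_lt_trans (probability_le1 _ _)) ?ltry//.
  by rewrite preimage_setT setIT.
- move=> x y xy; rewrite law_arrival_pair_quadrant// plane_densityE.
  transitivity (\int[leb \x leb]_(p in quadrant x y) ((pi * 'C(n, k.+1)%:R)%:E *
      ((k.+1 * l.+1)%:R * gd p)%:E)); last first.
    by apply: eq_integral => p _; rewrite -EFinM /G cE; congr EFin; ring.
  rewrite ge0_integralZl//.
  + by rewrite (integral_gap_density_quadrant Fnd F01 Ft hf) piE -!EFinM; congr EFin; ring.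
  + exact: measurable_quadrant.
  + by apply/measurable_EFinP/measurable_funTS; exact: measurable_funM.
  + by move=> p _; rewrite lee_fin mulr_ge0.
  + by rewrite lee_fin mulr_ge0.
- exact: measurableI.
- by move=> p [_ []].
Qed.

(** The inner domain is closed at y, whereas W requires x < y: the end point is
    negligible. *)
Lemma ge0_integral_arrival_pair (h : R * R -> \bar R) :
  (forall p, 0 <= h p) -> measurable_fun [set: R * R] h ->
  \int[P]_(w in [set w | N t w = n]) h (arrival_pair T i w)
  = count_prob P N t n * (c%:E *
      \int[leb]_(y in `[0%R, t]) \int[leb]_(x in `[0%R, y]) (h (x, y) * (gd (x, y))%:E)).
Proof.
move=> h0 mh; rewrite -(ge0_integral_law_on P (mN n) mpair)//.
rewrite (eq_measure_integral (plane_density GW0 mGW)); last first.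
  by move=> A mA _; exact: law_density.
rewrite ge0_integral_law_on// ge0_integral_density//.
pose H p := h p * (gd p * \1_W p)%:E.
have H0 p : 0 <= H p by rewrite mule_ge0// lee_fin mulr_ge0.
have mH : measurable_fun [set: R * R] H.
  apply: emeasurable_funM => //; apply/measurable_EFinP.
  exact: measurable_funM mgd (measurable_indic mW).
transitivity (\int[leb \x leb]_p ((pi * c)%:E * H p)).
  apply: eq_integral => p _; rewrite /H /GW /G muleCA -EFinM; congr (_ * _%:E).
  by ring.
rewrite ge0_integralZl//; last by rewrite lee_fin mulr_ge0.
rewrite piE muleA -EFinM; congr (_ * _).
transitivity (\int[leb]_y \int[leb]_x H (x, y)).
  exact: fubini_tonelli2.
rewrite [RHS]integral_mkcond.
apply: eq_integral => y _; rewrite patchE; case: ifPn; last first.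
  rewrite notin_setE/= in_itv/= => /negP yt.
  apply: integral0_eq => x _; rewrite /H.
  rewrite indicE memNset ?mulr0 ?mule0// => -[/= x0 xy yt'].
  by move/negP: yt; apply; rewrite yt' (le_trans x0)// ltW.
rewrite inE/= in_itv/= => /andP[y0 yt].
rewrite -integral_itv_bndo_bndc; last first.
  apply: measurable_funTS; apply: emeasurable_funM.
    exact: (measurable_fun_pair1 _ mh).
  apply/measurable_EFinP; exact: (measurable_fun_pair1 _ mgd).
rewrite [RHS]integral_mkcond; apply: eq_integral => x _.
rewrite patchE /H; case: ifPn; rewrite ?notin_setE ?inE/= in_itv/=.
  by move=> /andP[x0 xy]; rewrite indicE mem_set ?mulr1.
move=> /negP xy; rewrite indicE memNset ?mulr0 ?mule0// => -[/= x0 xy' _].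
by move/negP: xy; apply; rewrite x0 xy'.
Qed.

End joint.

Section first_arrival.
Variable n : nat.
Hypothesis n_gt0 : (0 < n)%N.
Hypothesis pi_gt0 : 0 < count_prob P N t n.

Let marr : measurable_fun [set: Om] (arrival T 1).
Proof. exact: (measurable_arrival hTN). Qed.

Let mu : {measure set R -> \bar R} := law_on P (mN n) marr.

Lemma law_arrival1_gt y :
  mu `]y, +oo[%classic = count_prob P N t n * ((1 - F t y) ^+ n)%:E.
Proof.
have [_ _ /(_ _ pi_gt0)[d' [Om' [Q [U [hU hF hT]]]]]] := hOS t_gt0.
pose a : 'I_n := Ordinal n_gt0.
pose B : set (n.-tuple R) := [set v | (y < tnth v a)%R].
have mB : measurable B.
  have -> : B = (fun v : n.-tuple R => tnth v a) @^-1` `]y, +oo[.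
    by apply/seteqP; split => v /=; rewrite !in_itv/= andbT.
  rewrite -[X in measurable X]setTI; exact: measurable_tnth.
transitivity (P ([set w | N t w = n] `&` arrival_tuple T n @^-1` B)).
  rewrite /mu/= /law_on; congr (P (_ `&` _)).
  by apply/seteqP; split => w; rewrite /B/= in_itv/= andbT tnth_mktuple.
rewrite hT//; congr (_ * _).
exact: (@prob_order_statistics_min _ _ _ Q n U (F t) hU hF y a erefl).
Qed.

Let gd (y : R) : R := (f y * (1 - F t y) ^+ n.-1)%R.
Let gd0 y : (0 <= gd y)%R.
Proof. by rewrite mulr_ge0// exprn_ge0// subr_ge0; case/andP: (F01 y). Qed.
Let mgd : measurable_fun [set: R] gd.
Proof.
apply: measurable_funM => //; apply: measurable_funX; apply: measurable_funB => //.
exact: nondecreasing_measurable.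
Qed.

Let pi : R := fine (count_prob P N t n).
Let piE : count_prob P N t n = pi%:E.
Proof. by rewrite fineK// fin_num_measure. Qed.
Let pi0 : (0 <= pi)%R. Proof. exact: fine_ge0. Qed.

Let G y : R := (pi * n%:R * gd y)%R.
Let G0 y : (0 <= G y)%R. Proof. by rewrite mulr_ge0// mulr_ge0. Qed.
Let mG : measurable_fun [set: R] G. Proof. exact: measurable_funM. Qed.

Let measurable_idR : measurable_fun [set: measurableTypeR R] (id : _ -> R).
Proof. exact: measurable_id. Qed.

Let nu : {measure set R -> \bar R} :=
  law_on (density_measure leb G0 mG) measurableT measurable_idR.

Let nuE A : nu A = \int[leb]_(y in A) (G y)%:E.
Proof. by rewrite /nu/= /law_on setTI. Qed.

Let law_density (A : set R) : measurable A -> mu A = nu A.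
Proof.
apply: (measure_unique (@RGenOInfty.G R) (fun k => `]- k%:R, +oo[%classic)%R).
- exact: RGenOInfty.measurableE.
- move=> _ _ [x ->] [y ->]; exists (Num.max x y).
  by apply/seteqP; split => z /=; rewrite !in_itv/= !andbT gt_max => /andP.
- by move=> k; exists (- k%:R)%R.
- apply/seteqP; split => // z _; exists (Num.truncn `|z|%R).+1 => //=.
  rewrite in_itv/= andbT ltrNl (le_lt_trans (ler_norm _))// normrN.
  exact: truncnS_gt.
- move=> _ [y ->]; rewrite law_arrival1_gt nuE.
  have := integral_ccdf_power Fnd F01 Ft hf n.-1 y; rewrite prednK// => <-.
  rewrite piE -ge0_integralZl//.
  + rewrite [RHS]integral_mkcond; apply: eq_integral => u _; rewrite patchE.
    case: ifPn; rewrite ?notin_setE ?inE/= in_itv/= andbT.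
      by move=> ->; rewrite mul1r -EFinM /G /gd; congr EFin; ring.
    by move=> /negP/negbTE ->; rewrite mul0r mule0.
  + apply/measurable_EFinP; apply: measurable_funM.
      apply: (@measurableT_comp _ _ _ _ _ _ (fun b : bool => b%:R : R)) => //.
      exact: measurable_fun_ltr.
    apply: measurable_funM => //; apply: measurable_funM => //.
    apply: measurable_funX; apply: measurable_funB => //.
    exact: nondecreasing_measurable.
  + move=> u _; rewrite lee_fin !mulr_ge0// exprn_ge0// subr_ge0.
    by case/andP: (F01 u).
- move=> k; rewrite /mu/= /law_on (le_lt_trans (probability_le1 _ _)) ?ltry//.
  apply: measurableI => //; rewrite -[X in measurable X]setTI; exact: marr.
Qed.

Lemma ge0_integral_arrival1 (h : R -> \bar R) :
  (forall y, 0 <= h y) -> measurable_fun [set: R] h ->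
  \int[P]_(w in [set w | N t w = n]) h (arrival T 1 w)
  = count_prob P N t n * (n%:R%:E *
      \int[leb]_(y in `[0%R, t]) (h y * (gd y)%:E)).
Proof.
move=> h0 mh; pose I := `[0%R, t]%classic.
have mI : measurable I by exact: measurable_itv.
pose hI y := h y * (\1_I y)%:E.
have hI0 y : 0 <= hI y by rewrite mule_ge0.
have mhI : measurable_fun [set: R] hI.
  by apply: emeasurable_funM => //; apply/measurable_EFinP; exact: measurable_indic.
transitivity (\int[P]_(w in [set w | N t w = n]) hI (arrival T 1 w)).
  apply: eq_integral => w /[!inE]/= Nn.
  rewrite /hI indicE mem_set ?mule1// /I/= in_itv/= (arrival_ge0 hTN)/=.
  by apply: (count_arrival_le hTN) => //; rewrite Nn.
rewrite -(ge0_integral_law_on P (mN n) marr)//.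
rewrite (eq_measure_integral nu); last by move=> A mA _; exact: law_density.
rewrite ge0_integral_law_on// ge0_integral_density//.
transitivity (\int[leb]_y ((pi * n%:R)%:E * (hI y * (gd y)%:E))).
  by apply: eq_integral => y _; rewrite /G muleCA -EFinM.
rewrite ge0_integralZl//; last 3 first.
- by apply: emeasurable_funM => //; exact/measurable_EFinP.
- by move=> y _; rewrite mule_ge0// lee_fin.
- by rewrite lee_fin mulr_ge0.
rewrite piE muleA -EFinM; congr (_ * _).
rewrite [RHS]integral_mkcond; apply: eq_integral => y _.
by rewrite epatch_indic /hI muleAC.
Qed.

End first_arrival.

End law_of_consecutive_arrivals.

(** * Regression functions on the events of the process *)

Section integral_uniqueness.
Context d (E : measurableType d) (R : realType) (nu : {measure set E -> \bar R}).
Hypothesis nu_fin : nu [set: E] < +oo.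

Let ae_eq_le_cst (u v : E -> \bar R) (r : R) : (0 <= r)%R ->
  measurable_fun [set: E] u -> measurable_fun [set: E] v ->
  \int[nu]_x u^\- x < +oo ->
  (forall B, measurable B -> \int[nu]_(x in B) u x = \int[nu]_(x in B) v x) ->
  ae_eq nu [set x | u x <= r%:E] u v.
Proof.
move=> r0 mu mv uneg uv.
have mB : measurable [set x | u x <= r%:E].
  rewrite -[X in measurable X]setTI; exact: emeasurable_fun_infty_c.
apply: integral_ae_eq => //; last by move=> B _; exact: uv.
  apply/integrableP; split; first exact: measurable_funTS.
  apply: (@le_lt_trans _ _ (\int[nu]_(x in [set x | u x <= r%:E]) (r%:E + u^\- x))).
    apply: ge0_le_integral => //.
    - by apply: measurableT_comp => //; exact: measurable_funTS.
    - apply: emeasurable_funD => //.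
      exact/measurable_funTS/measurable_funeneg.
    - move=> x /= ur; have -> : `|u x| = u^\+ x + u^\- x.
        by have /(congr1 (@^~ x)) := fune_abse u.
      rewrite leeD2r// funeposE ge_max ur/=.
      by rewrite lee_fin.
  rewrite ge0_integralD//; last exact/measurable_funTS/measurable_funeneg.
  apply: lte_add_pinfty.
    rewrite integral_cst//; apply: lte_mul_pinfty => //.
    by apply: le_lt_trans nu_fin; apply: le_measure; rewrite ?inE.
  apply: le_lt_trans uneg; apply: ge0_subset_integral => //.
  exact: measurable_funeneg.
exact: measurable_funTS.
Qed.

(** On the set u <= k the function u is integrable, so the equality of the
    integrals gives u = v almost everywhere there, and likewise on v <= k. Where
    none of these sets applies, both functions are +oo. *)
Lemma integral_ae_unique (u v : E -> \bar R) :
  measurable_fun [set: E] u -> measurable_fun [set: E] v ->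
  \int[nu]_x u^\- x < +oo -> \int[nu]_x v^\- x < +oo ->
  (forall B, measurable B -> \int[nu]_(x in B) u x = \int[nu]_(x in B) v x) ->
  ae_eq nu [set: E] u v.
Proof.
move=> mu mv uneg vneg uv.
have Nu (k : nat) := ae_eq_le_cst (ler0n R k) mu mv uneg uv.
have Nv (k : nat) := ae_eq_le_cst (ler0n R k) mv mu vneg (fun B mB => esym (uv B mB)).
have [U [mU U0 hU]] := negligible_bigcup Nu.
have [V [mV V0 hV]] := negligible_bigcup Nv.
exists (U `|` V); split; [exact: measurableU|by rewrite measureU0|].
move=> x /= /not_implyP[_ uvx].
have le_nat (z : \bar R) : z != +oo -> exists k : nat, z <= k%:R%:E.
  case: z => [r _| |_]; [|by rewrite eqxx|by exists 0%N; rewrite leNye].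
  exists (Num.truncn `|r|%R).+1; rewrite lee_fin (le_trans (ler_norm _))// ltW//.
  exact: truncnS_gt.
have [uoo|/le_nat[k uk]] := eqVneq (u x) +oo; last first.
  left; apply: hU; exists k => //= h; exact/uvx/h.
have [voo|/le_nat[k vk]] := eqVneq (v x) +oo; last first.
  by right; apply: hV; exists k => //= h; apply: uvx; rewrite h.
by exfalso; apply: uvx; rewrite uoo voo.
Qed.

End integral_uniqueness.

Lemma integral_law_on_restrict d d' (T : measurableType d) (E : measurableType d')
    (R : realType) (mu : {measure set T -> \bar R}) (D : set T) (Y : T -> E)
    (mD : measurable D) (mY : measurable_fun [set: T] Y) (h : E -> \bar R) B :
  measurable_fun [set: E] h -> measurable B ->
  \int[law_on mu mD mY]_(x in B) h x = \int[mu]_(w in D `&` Y @^-1` B) h (Y w).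
Proof.
move=> mh mB.
have ge0_case (g : E -> \bar R) : (forall x, 0 <= g x) -> measurable_fun [set: E] g ->
    \int[law_on mu mD mY]_(x in B) g x = \int[mu]_(w in D `&` Y @^-1` B) g (Y w).
  move=> g0 mg; rewrite [LHS]integral_mkcond ge0_integral_law_on.
  - rewrite integral_mkcondr; apply: eq_integral => w _.
    by rewrite !patchE.
  - by move=> x; rewrite patchE; case: ifP.
  - exact/(measurable_restrictT _ mB)/measurable_funTS.
rewrite [LHS]integralE [RHS]integralE; congr (_ - _).
  rewrite ge0_case//; last exact: measurable_funepos.
  by apply: eq_integral => w _; rewrite !funeposE.
rewrite ge0_case//; last exact: measurable_funeneg.
by apply: eq_integral => w _; rewrite !funenegE.
Qed.

Section regression_on_process_events.
Context d (Om : measurableType d) (R : realType) (P : probability Om R).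
Variables (T : nat -> Om -> \bar R) (N : R -> Om -> nat) (X : nat -> {RV P >-> R}).
Hypothesis hTN : claim_arrivals T N.
Hypothesis hX : depends_via_last_arrivals T N X.
Variable i : nat.
Hypothesis i_gt0 : (1 <= i)%N.
Hypothesis hXneg : \int[P]_(w in occurs T i) (EFin \o X i)^\- w < +oo.
Variable m : R * R -> \bar R.
Hypothesis hm : regression P (occurs T i) (X i) (arrival_pair T i) m.

Notation D := (occurs T i).
Notation Y := (arrival_pair T i).

Let mD : measurable D. Proof. exact: (measurable_occurs hTN). Qed.
Let mY : measurable_fun [set: Om] Y. Proof. exact: (measurable_arrival_pair hTN). Qed.
Let mX : measurable_fun [set: Om] (X i). Proof. exact: measurable_funPT. Qed.
Let mm : measurable_fun [set: R * R] m. Proof. by case: hm. Qed.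

Let kernel_mean (h : R -> \bar R) : (forall x, 0 <= h x) ->
  measurable_fun [set: R] h ->
  exists g : R * R -> \bar R, [/\ measurable_fun [set: R * R] g,
    forall p, 0 <= g p
    & forall A, process_sigma N A ->
        \int[P]_(w in A `&` D) h (X i w) = \int[P]_(w in A `&` D) g (Y w)].
Proof.
move=> h0 mh; have [kap hkap] := hX i_gt0.
have mkap U : measurable U -> measurable_fun [set: R * R] (kap ^~ U).
  exact: measurable_kernel.
exists (fun p => \int[kap p]_x h x); split.
- exact: measurable_fun_integral_kernel.
- by move=> p; exact: integral_ge0.
move=> A NA; have mAD : measurable (A `&` D).
  by apply: measurableI => //; exact: (process_sigma_measurable hTN).
rewrite -(ge0_integral_law_on P mAD mX)//.
rewrite [LHS](@ge0_integral_mixture _ _ _ _ _ P (A `&` D) (fun w => kap (Y w)))//.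
- by move=> U mU; exact: (measurableT_comp (mkap U mU) mY).
- by move=> U mU; rewrite /= /law_on; exact: hkap.
Qed.

Let process_pair B : measurable B -> process_sigma N (D `&` Y @^-1` B).
Proof. exact: (process_measurable_pair hTN). Qed.

Let process_integral_funeneg_lty (A : set Om) : process_sigma N A ->
  \int[P]_(w in A `&` D) (EFin \o X i)^\- w < +oo.
Proof.
move=> NA; have mA := process_sigma_measurable hTN NA.
apply: le_lt_trans hXneg; apply: ge0_subset_integral => //.
- exact: measurableI.
- by apply: measurable_funTS; apply: measurable_funeneg; exact/measurable_EFinP.
Qed.

(** The difference of the kernel means of the positive and of the negative part
    is a function of the last two arrival times whose integrals, unlike those of
    m, are known over every event of the process. *)
Let kernel_regression : exists u : R * R -> \bar R,
  [/\ measurable_fun [set: R * R] u,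
      \int[law_on P mD mY]_p u^\- p < +oo
    & forall A, process_sigma N A ->
        \int[P]_(w in A `&` D) (X i w)%:E = \int[P]_(w in A `&` D) u (Y w)].
Proof.
have mEF : measurable_fun [set: R] (@EFin R) by exact/measurable_EFinP.
have [g [mg g0 hg]] := kernel_mean (funepos_ge0 _) (measurable_funepos mEF).
have [h [mh h0 hh]] := kernel_mean (funeneg_ge0 _) (measurable_funeneg mEF).
have pos w : (@EFin R)^\+ (X i w) = (EFin \o X i)^\+ w by rewrite !funeposE.
have neg w : (@EFin R)^\- (X i w) = (EFin \o X i)^\- w by rewrite !funenegE.
have mgY : measurable_fun [set: Om] (g \o Y) by exact: measurableT_comp.
have mhY : measurable_fun [set: Om] (h \o Y) by exact: measurableT_comp.
exists (g \- h); split; first exact: emeasurable_funB.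
  apply: (@le_lt_trans _ _ (\int[law_on P mD mY]_p h p)).
    apply: ge0_le_integral => //.
      by apply: measurable_funeneg; exact: emeasurable_funB.
    move=> p _; rewrite funenegE/= ge_max h0 andbT.
    by rewrite leeNl -[leLHS]sub0e leeB.
  rewrite ge0_integral_law_on//.
  have := hh _ (process_pair measurableT); rewrite preimage_setT setIT setIid => <-.
  under eq_integral do rewrite neg; exact: hXneg.
move=> A NA; have mA := process_sigma_measurable hTN NA.
have mAD : measurable (A `&` D) by exact: measurableI.
rewrite ge0_integralB//; first last.
- by rewrite -hh//; under eq_integral do rewrite neg;
  exact: process_integral_funeneg_lty.
- exact: measurable_funTS.
- exact: measurable_funTS.
rewrite -hg// -hh//; under [X in _ = X - _]eq_integral do rewrite pos.
under [X in _ = _ - X]eq_integral do rewrite neg.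
by rewrite [LHS]integralE.
Qed.

(** Both functions have the same integral over every event of the sigma-algebra
    of Y; testing on the set m < 0 bounds the negative part of m, and then
    integral_ae_unique applies. *)
Let kernel_regression_eq : exists u : R * R -> \bar R,
  [/\ measurable_fun [set: R * R] u,
      \int[law_on P mD mY]_p m^\- p < +oo,
      ae_eq (law_on P mD mY) [set: R * R] u m
    & forall A, process_sigma N A ->
        \int[P]_(w in A `&` D) (X i w)%:E = \int[P]_(w in A `&` D) u (Y w)].
Proof.
have [u [mu uneg hu]] := kernel_regression; exists u.
have um B : measurable B ->
    \int[law_on P mD mY]_(x in B) u x = \int[law_on P mD mY]_(x in B) m x.
  move=> mB; rewrite !integral_law_on_restrict//.
  have [_ <-//] := hm; have := hu _ (process_pair mB).
  by rewrite -setIA [_ `&` D]setIC setIA setIid => <-.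
have mneg : \int[law_on P mD mY]_p m^\- p < +oo.
  pose B := [set p | m p < 0].
  have mB : measurable B.
    rewrite -[X in measurable X]setTI; exact: emeasurable_fun_infty_o.
  have -> : \int[law_on P mD mY]_p m^\- p = - \int[law_on P mD mY]_(p in B) u p.
    rewrite um// -integralN.
      rewrite [RHS]integral_mkcond; apply: eq_integral => p _.
      rewrite patchE funenegE; case: ifPn; rewrite ?notin_setE ?inE /B/=.
        by move=> mp; apply/max_idPl; rewrite oppe_ge0 ltW.
      by move=> /negP; rewrite -leNgt => mp; apply/max_idPr; rewrite oppe_le0.
    rewrite integral0_eq ?add0e// ?fin_num_adde_defr//.
    by move=> p mp; rewrite (le0_funeposE (D := B)) ?inE// => q /ltW.
  have Bneg : \int[law_on P mD mY]_(p in B) u^\- p < +oo.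
    apply: le_lt_trans uneg; apply: ge0_subset_integral => //.
    exact: measurable_funeneg.
  rewrite integralE fin_num_oppeB; last by rewrite ge0_fin_numE ?Bneg ?integral_ge0.
  by apply: le_lt_trans Bneg; rewrite geeDr// oppe_le0 integral_ge0.
split => //; apply: integral_ae_unique => //.
rewrite /= /law_on (le_lt_trans (probability_le1 _ _)) ?ltry//.
by rewrite preimage_setT setIT.
Qed.

Lemma regression_funeneg_lty : \int[P]_(w in D) m^\- (Y w) < +oo.
Proof.
have [u [_ mneg _ _]] := kernel_regression_eq.
by rewrite -(ge0_integral_law_on P mD mY)//; exact: measurable_funeneg.
Qed.

Lemma integral_regression A : process_sigma N A ->
  \int[P]_(w in A `&` D) (X i w)%:E = \int[P]_(w in A `&` D) m (Y w).
Proof.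
move=> NA; have [u [mu _ [M [mM M0 hM]] ->//]] := kernel_regression_eq.
have mAD : measurable (A `&` D).
  by apply: measurableI => //; exact: (process_sigma_measurable hTN).
apply: ae_eq_integral => //.
- by apply: measurable_funTS; exact: measurableT_comp.
- by apply: measurable_funTS; exact: measurableT_comp.
exists (D `&` Y @^-1` M); split => //.
  by apply: measurableI => //; rewrite -[X in measurable X]setTI; exact: mY.
move=> w /= /not_implyP[[Aw Dw] uw]; split => //.
by apply: hM => /= h; apply: uw; exact: h.
Qed.

End regression_on_process_events.

(** * Sums and partitions for functions with integrable negative part *)

Section quasi_integrable_sums.
Context d (T : measurableType d) (R : realType) (mu : {measure set T -> \bar R}).

Let sumeB (s : seq nat) (a b : nat -> \bar R) : (forall i, i \in s -> b i \is a fin_num) ->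
  \sum_(i <- s) a i - \sum_(i <- s) b i = \sum_(i <- s) (a i - b i).
Proof.
elim: s => [|j s IHs] bfin; first by rewrite !big_nil sube0.
rewrite !big_cons -IHs; last by move=> i si; apply: bfin; rewrite inE si orbT.
have bj : b j \is a fin_num by apply: bfin; rewrite inE eqxx.
by rewrite [b j + _]addeC fin_num_oppeD// [- _ - b j]addeC addeACA.
Qed.

Lemma integral_sum_funeneg_lty (D : set T) (s : seq nat) (f : nat -> T -> R) :
  measurable D -> (forall i, measurable_fun [set: T] (f i)) ->
  (forall i, i \in s -> \int[mu]_(x in D) (EFin \o f i)^\- x < +oo) ->
  \int[mu]_(x in D) (\sum_(i <- s) f i x)%:E
  = \sum_(i <- s) \int[mu]_(x in D) (f i x)%:E.
Proof.
move=> mD mf fneg.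
have mE i : measurable_fun [set: T] (EFin \o f i) by exact/measurable_EFinP.
have mp i : measurable_fun D (EFin \o f i)^\+.
  by apply: measurable_funTS; exact: measurable_funepos.
have mn i : measurable_fun D (EFin \o f i)^\-.
  by apply: measurable_funTS; exact: measurable_funeneg.
have neg_fin i : i \in s -> \int[mu]_(x in D) (EFin \o f i)^\- x \is a fin_num.
  by move=> si; rewrite ge0_fin_numE ?fneg ?integral_ge0.
transitivity (\int[mu]_(x in D) (\sum_(i <- s) (EFin \o f i)^\+ x
    - \sum_(i <- s) (EFin \o f i)^\- x)).
  apply: eq_integral => x _; rewrite sumeB; last first.
    by move=> i _; rewrite funenegE/= -EFin_max.
  rewrite -sumEFin; apply: eq_bigr => i _.
  by have /(congr1 (@^~ x)) := funeposneg (EFin \o f i).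
rewrite ge0_integralB//.
- rewrite !ge0_integral_sum// sumeB//; apply: eq_bigr => i _.
  by rewrite [RHS]integralE.
- exact: emeasurable_sum.
- exact: emeasurable_sum.
- by move=> x _; exact: sume_ge0.
- by move=> x _; exact: sume_ge0.
- rewrite ge0_integral_sum// big_seq; apply/lte_sum_pinfty => i; exact: fneg.
Qed.

Lemma integral_partition_funeneg_lty (A : nat -> set T) (f : T -> \bar R) :
  (forall n, measurable (A n)) -> trivIset setT A -> \bigcup_n A n = setT ->
  measurable_fun [set: T] f -> \int[mu]_x f^\- x < +oo ->
  \int[mu]_x f x = \sum_(0 <= n <oo) \int[mu]_(x in A n) f x.
Proof.
move=> mA tA UA mf fneg.
have cvg_part (g : T -> \bar R) : (forall x, 0 <= g x) -> measurable_fun [set: T] g ->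
    \sum_(0 <= n < k) \int[mu]_(x in A n) g x @[k --> \oo] --> \int[mu]_x g x.
  move=> g0 mg; rewrite -UA ge0_integral_bigcup//; last by rewrite UA.
  by apply: is_cvg_ereal_nneg_natsum => n _; exact: integral_ge0.
have mp := measurable_funepos mf; have mn := measurable_funeneg mf.
rewrite integralE; apply/esym/cvg_lim => //.
have -> : (fun k => \sum_(0 <= n < k) \int[mu]_(x in A n) f x) =
  (fun k => \sum_(0 <= n < k) \int[mu]_(x in A n) f^\+ x
          - \sum_(0 <= n < k) \int[mu]_(x in A n) f^\- x).
  apply/funext => k; rewrite sumeB; first by apply: eq_bigr => n _; exact: integralE.
  move=> n _; rewrite ge0_fin_numE ?integral_ge0//; apply: le_lt_trans fneg.
  exact: ge0_subset_integral.
apply: cvgeB; [|exact: cvg_part|exact: cvg_part].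
by rewrite fin_num_adde_defl// fin_numN ge0_fin_numE ?integral_ge0.
Qed.

End quasi_integrable_sums.

Lemma integral_funeposnegM d (T : measurableType d) (R : realType)
    (mu : {measure set T -> \bar R}) (A : set T) (h : T -> \bar R) (g : T -> R) :
  (forall x, (0 <= g x)%R) ->
  \int[mu]_(x in A) (h x * (g x)%:E)
  = \int[mu]_(x in A) (h^\+ x * (g x)%:E) - \int[mu]_(x in A) (h^\- x * (g x)%:E).
Proof.
move=> g0; rewrite integralE; congr (_ - _); apply: eq_integral => x _.
  by rewrite !funeposE maxe_pMl ?mul0e// lee_fin.
by rewrite !funenegE maxe_pMl ?mul0e ?mulNe// lee_fin.
Qed.

Section triangle_integral.
Context (R : realType).
Notation leb := (@lebesgue_measure R).
Variables (t : R) (h : R * R -> \bar R) (g : R * R -> R).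
Hypothesis mh : measurable_fun [set: R * R] h.
Hypothesis mg : measurable_fun [set: R * R] g.
Hypothesis g0 : forall p, (0 <= g p)%R.

Lemma measurable_triangle_section (k : R * R -> \bar R) :
  measurable_fun [set: R * R] k -> (forall p, 0 <= k p) ->
  measurable_fun `[0%R, t] (fun y => \int[leb]_(x in `[0%R, y]) (k (x, y) * (g (x, y))%:E)).
Proof.
move=> mk k0; apply: measurable_funTS.
pose b (p : R * R) : bool := ((0 <= p.1) && (p.1 <= p.2))%R.
pose H p := k p * (g p * (b p)%:R)%:E.
have mb : measurable_fun [set: R * R] b.
  by apply: measurable_and; apply: measurable_fun_ler.
have mH : measurable_fun [set: R * R] H.
  apply: emeasurable_funM => //; apply/measurable_EFinP; apply: measurable_funM => //.
  exact: (@measurableT_comp _ _ _ _ _ _ (fun b : bool => b%:R : R)).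
have H0 p : 0 <= H p by rewrite mule_ge0// lee_fin mulr_ge0.
rewrite (_ : (fun y => _) = fubini_G leb H).
  exact: measurable_fun_fubini_tonelli_G.
apply/funext => y; rewrite /fubini_G [LHS]integral_mkcond; apply: eq_integral => x _.
rewrite patchE /H /b; case: ifPn; rewrite ?notin_setE ?inE/= in_itv/=.
  by move=> ->; rewrite mulr1.
by move=> /negP/negbTE ->; rewrite mulr0 mule0.
Qed.

Lemma triangle_integral_funeposneg :
  \int[leb]_(y in `[0%R, t]) \int[leb]_(x in `[0%R, y]) (h^\- (x, y) * (g (x, y))%:E) < +oo ->
  \int[leb]_(y in `[0%R, t]) \int[leb]_(x in `[0%R, y]) (h (x, y) * (g (x, y))%:E)
  = \int[leb]_(y in `[0%R, t]) \int[leb]_(x in `[0%R, y]) (h^\+ (x, y) * (g (x, y))%:E)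
  - \int[leb]_(y in `[0%R, t]) \int[leb]_(x in `[0%R, y]) (h^\- (x, y) * (g (x, y))%:E).
Proof.
move=> negfin; rewrite -ge0_integralB//.
- apply: eq_integral => y _.
  rewrite (@integral_funeposnegM _ _ _ leb _ (fun x => h (x, y)) (fun x => g (x, y)))//.
  congr (_ - _); apply: eq_integral => x _; first by rewrite !funeposE.
  by rewrite !funenegE.
- by apply: measurable_triangle_section => //; exact: measurable_funepos.
- by apply: measurable_triangle_section => //; exact: measurable_funeneg.
- by move=> y _; apply: integral_ge0 => x _; rewrite mule_ge0// lee_fin.
- by move=> y _; apply: integral_ge0 => x _; rewrite mule_ge0// lee_fin.
Qed.

End triangle_integral.

(** Recombines the positive part a and the negative part b of a conditional
    integral: finiteness of the scaled negative part is all that is known at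
    first, and p and c being positive it gives back that of b. The last clause
    keeps -oo out of the sum over the claims. *)
Lemma scaled_difference (R : realType) (p c : R) (a b : \bar R) :
  (0 < p)%R -> (0 < c)%R -> 0 <= b -> p%:E * (c%:E * b) < +oo ->
  [/\ b < +oo, p%:E * (c%:E * a) - p%:E * (c%:E * b) = p%:E * (c%:E * (a - b))
    & 0 <= a -> c%:E * (a - b) != -oo].
Proof.
move=> p0 c0; case: b => [b| |]//; last first.
  by rewrite !gt0_muley ?lte_fin// ltxx.
move=> b0 _; split => //; first exact: ltry.
  rewrite [in RHS]muleBr ?fin_num_adde_defl// muleBr//.
  by rewrite fin_num_adde_defl// -EFinM.
case: a => [a| |]// a0.
by rewrite addye// gt0_muley// lte_fin.
Qed.

(** * Contribution of each claim *)

Section claim_terms.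
Context d (Om : measurableType d) (R : realType) (P : probability Om R).
Notation leb := (@lebesgue_measure R).
Variables (T : nat -> Om -> \bar R) (N : R -> Om -> nat) (X : nat -> {RV P >-> R}).
Variables (F : R -> cumulativeBounded (0 : R) (1 : R)) (t : R) (f : R -> R).
Variables (m1 : R -> \bar R) (m : nat -> R * R -> \bar R).
Hypothesis hTN : claim_arrivals T N.
Hypothesis hOS : os_point_process P T N F.
Hypothesis t_gt0 : (0 < t)%R.
Hypothesis hf : has_density (F t) f.
Hypothesis hX : depends_via_last_arrivals T N X.
Hypothesis hXneg : forall i, (1 <= i)%N ->
  \int[P]_(w in occurs T i) (EFin \o X i)^\- w < +oo.
Hypothesis hm1 : regression P (occurs T 1) (X 1%N) (arrival T 1) m1.
Hypothesis hm : forall i, (2 <= i)%N ->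
  regression P (occurs T i) (X i) (arrival_pair T i) (m i).

Definition claim_term (n i : nat) : \bar R :=
  if i is k.+2 then
    (n`!%:R / (k`! * (n - k.+2)`!)%:R)%:E *
      \int[leb]_(y in `[0%R, t]) \int[leb]_(x in `[0%R, y])
        (m i (x, y) * (gap_density (F t) f k (n - k.+2) (x, y))%:E)
  else n%:R%:E * \int[leb]_(y in `[0%R, t]) (m1 y * (f y * (1 - F t y) ^+ n.-1)%:E).

Let t0 : (0 <= t)%R. Proof. exact: ltW. Qed.
Let F01 x : (0 <= F t x <= 1)%R. Proof. exact: cumulative01_bounds. Qed.
Let Fnd : {homo F t : x y / (x <= y)%R}.
Proof. exact: cumulative_is_nondecreasing. Qed.
Let mf : measurable_fun [set: R] f. Proof. by case: hf. Qed.
Let f0 x : (0 <= f x)%R. Proof. by case: hf. Qed.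

Notation A n := [set w | N t w = n].

Let A_occurs n i : (i <= n)%N -> A n `&` occurs T i = A n.
Proof.
move=> ni; apply/setIidl => w /= Nn.
by apply: (count_occurs hTN t0); rewrite Nn.
Qed.

Let process_A n : process_sigma N (A n).
Proof. by apply: sub_sigma_algebra; exists t, n. Qed.

Let mA n : measurable (A n). Proof. exact: (measurable_count_eq hTN). Qed.

(** As T_0 = 0, the events of (T_0, T_1) are those of T_1; this puts the first
    claim in the setting of the others. *)
Let regression1_pair :
  regression P (occurs T 1) (X 1%N) (arrival_pair T 1) (fun p => m1 p.2).
Proof.
have [mm1 h1] := hm1; split; first exact: measurableT_comp.
move=> B mB; have Y w : arrival_pair T 1 w = (0%R, arrival T 1 w).
  by rewrite /arrival_pair (arrival0E hTN).
have -> : arrival_pair T 1 @^-1` B = arrival T 1 @^-1` [set y | B (0%R, y)].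
  by apply/seteqP; split => w /=; rewrite Y.
rewrite h1//.
have mpair : measurable_fun [set: R] (fun y : R => (0%R : R, y)).
  exact: measurable_fun_pair.
by have := mpair measurableT _ mB; rewrite setTI.
Qed.

(** The event [N t = n] belongs to the process and is contained in T_i < oo for
    i <= n; this is where the dependence hypothesis enters the formula. *)
Let integral_claim n i (r : R * R -> \bar R) : (1 <= i)%N -> (i <= n)%N ->
  regression P (occurs T i) (X i) (arrival_pair T i) r ->
  \int[P]_(w in A n) (X i w)%:E = \int[P]_(w in A n) r^\+ (arrival_pair T i w)
    - \int[P]_(w in A n) r^\- (arrival_pair T i w)
  /\ \int[P]_(w in A n) r^\- (arrival_pair T i w) < +oo.
Proof.
move=> i1 ni hr; split.
  have := integral_regression hTN hX i1 (hXneg i1) hr (process_A n).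
  rewrite A_occurs// => ->; rewrite integralE; congr (_ - _).
    by apply: eq_integral => w _; rewrite !funeposE.
  by apply: eq_integral => w _; rewrite !funenegE.
apply: le_lt_trans (regression_funeneg_lty hTN hX i1 (hXneg i1) hr).
have [mr _] := hr.
apply: ge0_subset_integral => //; first exact: (measurable_occurs hTN).
  apply: measurable_funTS; apply: measurableT_comp.
    exact: measurable_funeneg.
  exact: (measurable_arrival_pair hTN).
by rewrite -(A_occurs ni); exact: subIsetr.
Qed.

Lemma integral_claim1 n : (1 <= n)%N -> 0 < count_prob P N t n ->
  \int[P]_(w in A n) (X 1%N w)%:E = count_prob P N t n * claim_term n 1
  /\ claim_term n 1 != -oo.
Proof.
move=> n1 pi_gt0; have [p pE] := count_prob_fin P hTN t_gt0 n.
have [mm1 _] := hm1.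
have [-> negfin] := integral_claim (leqnn 1) n1 regression1_pair.
pose g y : R := (f y * (1 - F t y) ^+ n.-1)%R.
have g0 y : (0 <= g y)%R.
  by rewrite mulr_ge0// exprn_ge0// subr_ge0; case/andP: (F01 y).
have mg : measurable_fun [set: R] g.
  apply: measurable_funM => //; apply: measurable_funX; apply: measurable_funB => //.
  exact: nondecreasing_measurable.
have partE (h : R -> \bar R) (H : R * R -> \bar R) : (forall p, H p = h p.2) ->
    (forall y, 0 <= h y) -> measurable_fun [set: R] h ->
    \int[P]_(w in A n) H (arrival_pair T 1 w)
    = p%:E * (n%:R%:E * \int[leb]_(y in `[0%R, t]) (h y * (g y)%:E)).
  move=> HE h0 mh; rewrite -pE -(ge0_integral_arrival1 hTN hOS t_gt0 hf n1 pi_gt0)//.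
  by apply: eq_integral => w _; rewrite HE.
have posE := partE m1^\+ (fun p => m1 p.2)^\+ _ (funepos_ge0 _) (measurable_funepos mm1).
have negE := partE m1^\- (fun p => m1 p.2)^\- _ (funeneg_ge0 _) (measurable_funeneg mm1).
have {}posE := posE (fun p => ltac:(by rewrite !funeposE)).
have {}negE := negE (fun p => ltac:(by rewrite !funenegE)).
rewrite posE negE pE; rewrite negE in negfin.
have p_gt0 : (0 < p)%R by rewrite -lte_fin -pE.
have n_gt0 : (0 < n%:R :> R)%R by rewrite ltr0n.
have int_ge0 (h : R -> \bar R) : (forall y, 0 <= h y) ->
    0 <= \int[leb]_(y in `[0%R, t]) (h y * (g y)%:E).
  by move=> h0; apply: integral_ge0 => y _; rewrite mule_ge0// lee_fin.
have [_ -> NyE] := scaled_difference (\int[leb]_(y in `[0%R, t]) (m1^\+ y * (g y)%:E))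
  p_gt0 n_gt0 (int_ge0 _ (funeneg_ge0 _)) negfin.
rewrite /claim_term (@integral_funeposnegM _ _ _ leb _ m1 g)//.
by split => //; apply: NyE; exact: int_ge0.
Qed.

Lemma integral_claim2 n k l : n = (k + l).+2 -> 0 < count_prob P N t n ->
  \int[P]_(w in A n) (X k.+2 w)%:E = count_prob P N t n * claim_term n k.+2
  /\ claim_term n k.+2 != -oo.
Proof.
move=> nE; rewrite nE => pi_gt0; have [p pE] := count_prob_fin P hTN t_gt0 (k + l).+2.
have [mm2 _] := hm (isT : (2 <= k.+2)%N).
have kn : (k.+2 <= (k + l).+2)%N by rewrite !ltnS leq_addr.
have [-> negfin] := integral_claim (ltn0Sn k.+1) kn (hm (isT : (2 <= k.+2)%N)).
rewrite /claim_term (_ : (k + l).+2 - k.+2 = l)%N; last by rewrite !subSS addKn.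
set g := gap_density (F t) f k l.
have g0 q : (0 <= g q)%R by exact: (gap_density_ge0 F01 hf).
have mg : measurable_fun [set: R * R] g by exact: (measurable_gap_density Fnd hf).
set c := (_ / _)%R.
have c_gt0 : (0 < c)%R by rewrite /c divr_gt0// ltr0n ?fact_gt0// muln_gt0 !fact_gt0.
have partE h := ge0_integral_arrival_pair (h := h) hTN hOS t_gt0 hf pi_gt0.
have posE := partE _ (funepos_ge0 _) (measurable_funepos mm2).
have negE := partE _ (funeneg_ge0 _) (measurable_funeneg mm2).
rewrite posE negE; rewrite negE in negfin.
rewrite pE in negfin *.
have p_gt0 : (0 < p)%R by rewrite -lte_fin -pE.
have int_ge0 (h : R * R -> \bar R) : (forall y, 0 <= h y) ->
    0 <= \int[leb]_(y in `[0%R, t]) \int[leb]_(x in `[0%R, y]) (h (x, y) * (g (x, y))%:E).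
  move=> h0; apply: integral_ge0 => y _; apply: integral_ge0 => x _.
  by rewrite mule_ge0// lee_fin.
have [negfin' -> NyE] := scaled_difference (\int[leb]_(y in `[0%R, t])
    \int[leb]_(x in `[0%R, y]) ((m k.+2)^\+ (x, y) * (g (x, y))%:E))
  p_gt0 c_gt0 (int_ge0 _ (funeneg_ge0 _)) negfin.
rewrite (triangle_integral_funeposneg (h := m k.+2))//.
by split => //; apply: NyE; exact: int_ge0.
Qed.

End claim_terms.

Lemma fin_sume_distrr (R : realType) (p : R) (s : seq nat) (b : nat -> \bar R) :
  (forall i, i \in s -> b i != -oo) ->
  p%:E * \sum_(i <- s) b i = \sum_(i <- s) p%:E * b i.
Proof.
have ne_oo (s' : seq nat) : (forall i, i \in s' -> b i != -oo) ->
    \sum_(i <- s') b i != -oo.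
  elim: s' => [|j s' IHs] bN; first by rewrite big_nil.
  rewrite big_cons adde_eq_ninfty negb_or bN ?inE ?eqxx//=.
  by apply: IHs => i si; apply: bN; rewrite inE si orbT.
elim: s => [|j s IHs] bN; first by rewrite !big_nil mule0.
have bs i : i \in s -> b i != -oo by move=> si; apply: bN; rewrite inE si orbT.
rewrite !big_cons -IHs// muleDr// ltninfty_adde_def// inE ltNye.
  by apply: bN; rewrite inE eqxx.
exact: ne_oo.
Qed.

(** * Expectation of the aggregate claim size *)

Section expected_aggregate.
Context d (Om : measurableType d) (R : realType) (P : probability Om R).
Variables (T : nat -> Om -> \bar R) (N : R -> Om -> nat) (X : nat -> {RV P >-> R}).
Variables (F : R -> cumulativeBounded (0 : R) (1 : R)) (t : R) (f : R -> R).
Variables (m1 : R -> \bar R) (m : nat -> R * R -> \bar R).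
Hypothesis hTN : claim_arrivals T N.
Hypothesis hOS : os_point_process P T N F.
Hypothesis t_gt0 : (0 < t)%R.
Hypothesis hf : has_density (F t) f.
Hypothesis hX : depends_via_last_arrivals T N X.
Hypothesis hXneg : forall i, (1 <= i)%N ->
  \int[P]_(w in occurs T i) (EFin \o X i)^\- w < +oo.
Hypothesis hSneg : \int[P]_w (EFin \o aggregate N X t)^\- w < +oo.
Hypothesis hm1 : regression P (occurs T 1) (X 1%N) (arrival T 1) m1.
Hypothesis hm : forall i, (2 <= i)%N ->
  regression P (occurs T i) (X i) (arrival_pair T i) (m i).

Let t0 : (0 <= t)%R. Proof. exact: ltW. Qed.
Notation A n := [set w | N t w = n].
Let mA n : measurable (A n). Proof. exact: (measurable_count_eq hTN). Qed.
Let mX i : measurable_fun [set: Om] (X i). Proof. exact: measurable_funPT. Qed.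

Let aggregateE n w : A n w -> aggregate N X t w = (\sum_(1 <= i < n.+1) X i w)%R.
Proof. by rewrite /aggregate => /= ->. Qed.

Lemma integral_aggregate n :
  \int[P]_(w in A n) (aggregate N X t w)%:E
  = count_prob P N t n * \sum_(1 <= i < n.+1) claim_term F t f m1 m n i.
Proof.
transitivity (\int[P]_(w in A n) (\sum_(1 <= i < n.+1) X i w)%:E).
  by apply: eq_integral => w /[!inE]/= Nn; rewrite (aggregateE Nn).
rewrite integral_sum_funeneg_lty//; last first.
  move=> i; rewrite mem_index_iota ltnS => /andP[i1 ni].
  apply: le_lt_trans (hXneg i1); apply: ge0_subset_integral => //.
  - exact: (measurable_occurs hTN).
  - by apply: measurable_funTS; apply: measurable_funeneg; exact/measurable_EFinP.
  - by move=> w /= Nn; apply: (count_occurs hTN t0); rewrite Nn.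
have [pi0|pi_neq0] := eqVneq (count_prob P N t n) 0.
  rewrite pi0 mul0e big1// => i _.
  rewrite (ae_eq_integral (cst 0)) ?integral0//.
  - by apply: measurable_funTS; exact/measurable_EFinP.
  - by exists (A n); split => // w /= /not_implyP[].
have pi_gt0 : 0 < count_prob P N t n by rewrite lt0e pi_neq0 measure_ge0.
have term i : i \in index_iota 1 n.+1 ->
    \int[P]_(w in A n) (X i w)%:E = count_prob P N t n * claim_term F t f m1 m n i
    /\ claim_term F t f m1 m n i != -oo.
  rewrite mem_index_iota ltnS => /andP[]; case: i => [//|[|k]] _ ni.
    exact: (integral_claim1 m hTN hOS t_gt0 hf hX hXneg hm1 ni pi_gt0).
  have nE : n = (k + (n - k.+2)).+2 by rewrite -!addSn subnKC.
  exact: (integral_claim2 m1 hTN hOS t_gt0 hf hX hXneg hm nE pi_gt0).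
have [p pE] := count_prob_fin P hTN t_gt0 n.
rewrite pE fin_sume_distrr; last by move=> i /term[].
by rewrite -pE; apply: eq_big_seq => i /term[].
Qed.

Let measurable_aggregate : measurable_fun [set: Om] (aggregate N X t).
Proof.
have -> : [set: Om] = \bigcup_n A n.
  by apply/seteqP; split => // w _; exists (N t w).
apply/measurable_fun_bigcup => // n.
apply: (eq_measurable_fun (fun w => \sum_(1 <= i < n.+1) X i w)%R).
  by move=> w /[!inE] /aggregateE ->.
by apply: measurable_funTS; exact: measurable_sum.
Qed.

Lemma expectation_aggregate : 'E_P[aggregate N X t] =
  \sum_(1 <= n <oo) count_prob P N t n *
    \sum_(1 <= i < n.+1) claim_term F t f m1 m n i.
Proof.
rewrite unlock (@integral_partition_funeneg_lty _ _ _ _ (fun n => A n))//.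
- congr (limn _); apply/funext => -[|k]; first by rewrite !big_nil.
  rewrite big_ltn// [X in X + _](_ : _ = 0) ?add0e.
    by apply: eq_bigr => n _; exact: integral_aggregate.
  by rewrite integral_aggregate big_nil mule0.
- by move=> i j _ _ [w [/= <- <-]].
- by apply/seteqP; split => // w _; exists (N t w).
- exact/measurable_EFinP.
Qed.

End expected_aggregate.

Theorem theorem2p1 (R : realType) (d : measure_display) (Om : measurableType d)
    (P : probability Om R)
    (T : nat -> Om -> \bar R) (N : R -> Om -> nat) (X : nat -> {RV P >-> R})
    (F : R -> cumulativeBounded (0 : R) (1 : R)) (t : R) (f : R -> R)
    (m1 : R -> \bar R) (m : nat -> R * R -> \bar R)
    (hTN : claim_arrivals T N)
    (hOS : os_point_process P T N F)
    (ht : (0 < t)%R)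
    (hf : has_density (F t) f)
    (hX : depends_via_last_arrivals T N X)
    (* E[X_i ; T_i < oo] and E[S(t)] exist in ]-oo, +oo] *)
    (hXneg : forall i, (1 <= i)%N ->
       \int[P]_(w in occurs T i) (EFin \o X i)^\- w < +oo)
    (hSneg : \int[P]_w (EFin \o aggregate N X t)^\- w < +oo)
    (* m1 y = E[X_1 | T_1 = y], m i (x, y) = E[X_i | T_{i-1} = x, T_i = y] *)
    (hm1 : regression P (occurs T 1) (X 1%N) (arrival T 1) m1)
    (hm : forall i, (2 <= i)%N ->
       regression P (occurs T i) (X i) (arrival_pair T i) (m i)) :
  'E_P[aggregate N X t] =
  \sum_(1 <= n <oo) count_prob P N t n *
    (n%:R%:E * \int[lebesgue_measure]_(y in `[0%R, t])
                 (m1 y * (f y * (1 - F t y) ^+ n.-1)%:E)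
     + \sum_(2 <= i < n.+1)
         (n`!%:R / ((i - 2)`! * (n - i)`!)%:R)%:E *
         \int[lebesgue_measure]_(y in `[0%R, t])
           \int[lebesgue_measure]_(x in `[0%R, y])
             (m i (x, y) *
              (f x * f y * F t x ^+ (i - 2) * (1 - F t y) ^+ (n - i))%:E)).
Proof.
rewrite (expectation_aggregate hTN hOS ht hf hX hXneg hSneg hm1 hm).
congr (limn _); apply/funext => k; apply: eq_big_nat => n /andP[n1 _].
rewrite big_ltn//; congr (_ * (_ + _)).
apply: eq_big_nat => i /andP[i2 _].
case: i i2 => [i2|[i2|i _]]; [by exfalso|by exfalso|].
rewrite [in RHS](_ : (i.+2 - 2)%N = i); last by rewrite subn2.
congr (_ * _); apply: eq_integral => y _; apply: eq_integral => x _.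
Qed.
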